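(* Let $0\le k\le n$ be integers with $n\ge 1$ and let $\alpha_1,\ldots,\alpha_n$ be indeterminates. The sum of the weights of all maximal chains in the circular Bruhat order $\mathrm{CB}(k,n)$ equals \[ f(k,n)\,(\alpha_1+\alpha_2+\cdots+\alpha_n)^{k(n-k)}, \] where $f(k,n)$ is the number of standard Young tableaux of the $k\times(n-k)$ rectangular shape.
   Context: An affine permutation is a bijection $f\colon\mathbb{Z}\to\mathbb{Z}$ with $f(i+n)=f(i)+n$ for all $i\in\mathbb{Z}$; it is determined by its window $[f(1),\ldots,f(n)]$. Products are compositions: $(fg)(i)=f(g(i))$. Let $\mathrm{CB}(k,n)$ be the set of affine permutations $f$ with $\frac1n\sum_{i=1}^n(f(i)-i)=k$ and $i\le f(i)\le i+n$ for all $i\in\mathbb{Z}$ (bounded affine permutations). The length $\ell(f)$ is the number of equivalence classes of pairs $(i,j)\in\mathbb{Z}^2$ with $i<j$ and $f(i)>f(j)$, where $(i,j)\sim(i+rn,j+rn)$ for $r\in\mathbb{Z}$. For $i\neq j$ in $[n]=\{1,\ldots,n\}$, let $t_{ij}$ be the affine permutation with window $[1,\ldots,i-1,j,i+1,\ldots,j-1,i,j+1,\ldots,n]$ if $i<j$, and with window $[1,\ldots,j-1,i-n,j+1,\ldots,i-1,j+n,i+1,\ldots,n]$ if $i>j$. The circular Bruhat order on $\mathrm{CB}(k,n)$ is the partial order whose cover relations are: $g\lessdot f$ iff $g=ft_{ij}$ for some $i\neq j$ in $[n]$ and $\ell(g)=\ell(f)+1$. (Its unique maximum is $[1+k,2+k,\ldots,n+k]$.)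 The weight of a cover $ft_{ij}\lessdot f$ is $\alpha_i+\alpha_{i+1}+\cdots+\alpha_{j-1}$ if $i<j$, and $\alpha_i+\cdots+\alpha_n+\alpha_1+\cdots+\alpha_{j-1}$ if $i>j$. The weight of a saturated chain is the product of the weights of its cover relations (the chain with no covers has weight $1$). *)

(* Defs.v *)
From Stdlib Require Import Relation_Operators.
From HB Require Import structures.
From mathcomp Require Import all_boot all_order all_algebra.
From mathcomp Require Import finmap boolp classical_sets functions cardinality.
From mathcomp Require Import fsbigop mpoly zify.

Set Implicit Arguments.
Unset Strict Implicit.
Unset Printing Implicit Defensive.

Import Order.TTheory GRing.Theory Num.Theory.

Local Open Scope classical_set_scope.
Local Open Scope ring_scope.

Definition affine_perm (n : nat) (f : int -> int) : Prop :=
  bijective f /\ forall i : int, f (i + n%:Z) = f i + n%:Z.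

Definition CB (k n : nat) : set (int -> int) :=
  [set f | [/\ affine_perm n f,
               n%:R^-1 * (\sum_(1 <= i < n.+1) (f i%:Z - i%:Z))%:~R = k%:R :> rat
             & forall i : int, i <= f i <= i + n%:Z]].

Definition shift_class (n : nat) (p : int * int) : set (int * int) :=
  [set q | exists r : int, q = (p.1 + r * n%:Z, p.2 + r * n%:Z)].

Definition inversions (f : int -> int) : set (int * int) :=
  [set p | p.1 < p.2 /\ f p.2 < f p.1].

(* For an affine permutation with n > 0 the set of classes is finite; on an
   infinite set [fset_set] would return the empty set. *)
Definition aff_length (n : nat) (f : int -> int) : nat :=
  #|` fset_set [set shift_class n p | p in inversions f]|.

(* The n-periodic extension of a window w(1), ..., w(n). *)
Definition of_window (n : nat) (w : nat -> int) (m : int) : int :=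
  w `|((m - 1) %% n%:Z)%Z|.+1 + ((m - 1) %/ n%:Z)%Z * n%:Z.

Definition t_window (n i j m : nat) : int :=
  if (i < j)%N then
    if m == i then j%:Z else if m == j then i%:Z else m%:Z
  else
    if m == j then i%:Z - n%:Z else if m == i then j%:Z + n%:Z else m%:Z.

Definition aff_t (n i j : nat) : int -> int := of_window n (t_window n i j).

Lemma of_windowE (n : nat) (w : nat -> int) (m : nat) :
  (1 <= m <= n)%N -> of_window n w m%:Z = w m.
Proof.
case: m => // m /= lt_mn; rewrite /of_window.
have -> : m.+1%:Z - 1 = m%:Z by lia.
by rewrite modz_small ?divz_small ?mul0r ?addr0 //; lia.
Qed.

Lemma aff_t_inj (n i j i' j' : nat) :
  (1 <= i <= n)%N -> (1 <= j <= n)%N -> i != j ->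
  (1 <= i' <= n)%N -> (1 <= j' <= n)%N -> i' != j' ->
  aff_t n i j = aff_t n i' j' -> i = i' /\ j = j'.
Proof.
move=> hi hj nij hi' hj' nij' e.
have E m : (1 <= m <= n)%N -> t_window n i j m = t_window n i' j' m.
  move=> hm; rewrite -[LHS](of_windowE _ hm) -[RHS](of_windowE _ hm).
  by rewrite -/(aff_t n i j) e.
have := E _ hi; have := E _ hj; rewrite /t_window !eqxx.
by do ![case: ifP => ?]; lia.
Qed.

Definition cb_cover (k n : nat) (g f : int -> int) : Prop :=
  [/\ CB k n g, CB k n f
    & exists i j : nat,
        [/\ (1 <= i <= n)%N, (1 <= j <= n)%N, i != j, g = f \o aff_t n i j
          & aff_length n g = (aff_length n f).+1]].

Definition cb_le (k n : nat) : (int -> int) -> (int -> int) -> Prop :=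
  clos_refl_trans (int -> int) (cb_cover k n).

Definition cb_chain (k n : nat) (C : set (int -> int)) : Prop :=
  C `<=` CB k n /\ total_on C (cb_le k n).

Definition maximal_chains (k n : nat) : set (set (int -> int)) :=
  [set C | cb_chain k n C /\
           forall D, cb_chain k n D -> C `<=` D -> D = C].

(* The indeterminate alpha_m, for 1 <= m <= n, is 'X_(m - 1). *)
Definition t_weight (n i j : nat) : {mpoly int[n]} :=
  if (i < j)%N then \sum_(m < n | (i <= m.+1 < j)%N) 'X_m
  else \sum_(m < n | (i <= m.+1)%N) 'X_m + \sum_(m < n | (m.+1 < j)%N) 'X_m.

(* At most one pair (i, j) satisfies g = f t_ij, since f is injective and the
   t_ij are pairwise distinct (lemma [aff_t_inj]), so on a cover this sum has
   exactly one term. *)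
Definition cover_weight (n : nat) (g f : int -> int) : {mpoly int[n]} :=
  \sum_(1 <= i < n.+1)
    \sum_(1 <= j < n.+1 | (i != j) && `[< g = f \o aff_t n i j >])
      t_weight n i j.

Definition chain_weight (k n : nat) (C : set (int -> int)) : {mpoly int[n]} :=
  \big[*%R/1]_(p \in [set p | [/\ C p.1, C p.2 & cb_cover k n p.1 p.2]])
    cover_weight n p.1 p.2.

(* Standard Young tableaux of rectangular shape with a rows and b columns; the
   ordinal v stands for the entry v + 1. *)
Definition is_rect_syt (a b : nat) (T : {ffun 'I_a * 'I_b -> 'I_(a * b)}) :
    bool :=
  [&& [forall v, #|[set c | T c == v]%SET| == 1%N],
      [forall r : 'I_a, forall c : 'I_b, forall c' : 'I_b,
         (c < c')%N ==> (T (r, c) < T (r, c'))%N]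
    & [forall c : 'I_b, forall r : 'I_a, forall r' : 'I_a,
         (r < r')%N ==> (T (r, c) < T (r', c))%N]].

Definition num_rect_syt (a b : nat) : nat :=
  #|[set T : {ffun 'I_a * 'I_b -> 'I_(a * b)} | is_rect_syt T]%SET|.

(* Main.v *)
(* Write U(f) for the weighted sum of the lower covers f t_ij of f. The bracket
   operators [ab], sending f to the cover f t_ab with the sign of b - a, satisfy
   the relations of the Fomin-Kirillov algebra, so the Dunkl elements
   V_p = sum_q [pq] commute with U. By descending induction on the length, the
   total weight of the chains descending to a minimal element is killed by every
   V_p: at the last step f has exactly two lower covers, which cancel.
   The weight of a cover is lam(b) - lam(a) with lam(x + n) = lam(x) + A, where
   A = alpha_1 + ... + alpha_n, and replacing lam by the step function
   A * floor((x - 1) / n) changes U by a combination of the V_p. Hence the total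
   weight is A^(k(n-k)) times the number of chains all of whose weights involve
   alpha_n. Such chains run through elements with increasing window, which are
   encoded by Young diagrams in the k x (n - k) rectangle, and each step adds a
   box, so they are counted by standard Young tableaux. *)

Require Import Defs.
From Stdlib Require Import Relation_Operators.
From mathcomp Require Import all_boot all_order all_algebra.
From mathcomp Require Import finmap boolp classical_sets functions cardinality.
From mathcomp Require Import fsbigop mpoly zify ring.

Set Implicit Arguments.
Unset Strict Implicit.
Unset Printing Implicit Defensive.

Import Order.TTheory GRing.Theory Num.Theory.

Local Open Scope classical_set_scope.
Local Open Scope ring_scope.

(** * Periodic sums and affine reflections *)

(** The obstacle is that [CB k n] truncates the affine group, so each bracket relation must survive
    the removal of unbounded maps. It does, because an ascent a < b, f a < f b that ends at a
    bounded map starts at a bounded map and satisfies b <= f a < f b <= a + n. Hence the middle of a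
    two-step chain needs no separate check, and every arc is shorter than n, so that the sums are
    finite. The same inequalities supply a relation without algebraic reason: [a b] followed by
    [a, b + m n] vanishes for every m, although for nonzero m the product of the two reflections is
    a nontrivial translation. The exponent k(n - k) is the common length of the minimal elements,
    the maps with f x in {x, x + n}: each of the k moved classes is inverted once with each of the n
    - k fixed ones. *)

Lemma eq_big_supp (T : eqType) (V : nmodType) (r1 r2 : seq T) (F : T -> V) :
  uniq r1 -> uniq r2 -> (forall x, F x != 0 -> (x \in r1) = (x \in r2)) ->
  \sum_(x <- r1) F x = \sum_(x <- r2) F x.
Proof.
move=> u1 u2 e12.
have supp r : \sum_(x <- r) F x = \sum_(x <- [seq x <- r | F x != 0]) F x.
  rewrite big_filter [LHS](bigID (fun x => F x != 0)) /= [X in _ + X]big1 ?addr0 //.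
  by move=> i /negPn/eqP.
rewrite (supp r1) (supp r2); apply: perm_big.
apply: uniq_perm; rewrite ?filter_uniq // => x; rewrite !mem_filter.
by case: eqP => //= /eqP/e12.
Qed.

Lemma sum_reindex (T U : eqType) (V : nmodType) (r1 : seq T) (r2 : seq U)
    (h : T -> U) (F : U -> V) :
  injective h -> uniq r1 -> uniq r2 ->
  (forall y, F y != 0 -> (y \in map h r1) = (y \in r2)) ->
  \sum_(x <- r1) F (h x) = \sum_(y <- r2) F y.
Proof.
move=> hI u1 u2 e; rewrite -(big_map h predT F).
by apply: eq_big_supp => //; rewrite map_inj_uniq.
Qed.

Definition irange (s : int) (N : nat) : seq int := [seq s + x%:Z | x <- iota 0 N].

Lemma mem_irange s N x : (x \in irange s N) = (s <= x < s + N%:Z).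
Proof.
apply/mapP/idP => [[y]|h]; first by rewrite mem_iota => ? ->; lia.
by exists `|x - s|%N; rewrite ?mem_iota; lia.
Qed.

Lemma irange_uniq s N : uniq (irange s N).
Proof. by rewrite map_inj_uniq ?iota_uniq // => x y; lia. Qed.

Lemma irangeS s N : irange s N.+1 = s :: irange (s + 1) N.
Proof.
rewrite /irange /= addr0; congr (_ :: _).
rewrite -[1%N]/(1 + 0)%N iotaDl -map_comp; apply: eq_map => x /=; lia.
Qed.

Lemma sum_irange_shift (V : nmodType) (F : int -> V) s N c :
  \sum_(x <- irange s N) F (x + c) = \sum_(x <- irange (s + c) N) F x.
Proof.
apply: (sum_reindex (h := fun x => x + c)) => [x y|||y _]; rewrite ?irange_uniq //; first lia.
rewrite mem_irange; apply/mapP/idP => [[x]|h]; first by rewrite mem_irange => ? ->; lia.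
by exists (y - c); rewrite ?mem_irange; lia.
Qed.

Lemma sum_irange_opp (V : nmodType) (F : int -> V) s N :
  \sum_(x <- irange s N) F (- x) = \sum_(x <- irange (1 - s - N%:Z) N) F x.
Proof.
apply: (sum_reindex (h := fun x => - x)) => [x y|||y _]; rewrite ?irange_uniq //; first lia.
rewrite mem_irange; apply/mapP/idP => [[x]|h]; first by rewrite mem_irange => ? ->; lia.
by exists (- y); rewrite ?mem_irange; lia.
Qed.

Lemma sum_irange_nat (V : nmodType) (F : int -> V) s N :
  \sum_(x <- irange s N) F x = \sum_(x < N) F (s + x%:Z).
Proof. by rewrite big_map -[in iota _ _](subn0 N) big_mkord. Qed.

Section Reflections.
Variable n : nat.

Definition periodic (V : Type) (H : int -> V) := forall x, H (x + n%:Z) = H x.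

Lemma periodicM (V : Type) (H : int -> V) (y x : int) :
  periodic H -> H (x + y * n%:Z) = H x.
Proof.
move=> pH; have pos m z : H (z + m%:Z * n%:Z) = H z.
  elim: m => [|m IH]; first by rewrite mul0r addr0.
  by rewrite -addn1 PoszD mulrDl mul1r addrA pH IH.
case: y => m; first exact: pos.
by rewrite -(pos m.+1 (x + _)); congr H; rewrite NegzE; ring.
Qed.

Lemma sum_window (V : zmodType) (H : int -> V) s s' :
  periodic H -> \sum_(x <- irange s n) H x = \sum_(x <- irange s' n) H x.
Proof.
have [n0|n_gt0] := posnP n; first by rewrite n0 /irange !big_nil.
move=> pH; have step z : \sum_(x <- irange z n) H x = \sum_(x <- irange (z + 1) n) H x.
  have -> : n = n.-1.+1 by lia.
  rewrite irangeS big_cons !sum_irange_nat big_ord_recr /= addrC; congr (_ + _).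
  by rewrite -(pH z); congr H; lia.
have pos m z : \sum_(x <- irange z n) H x = \sum_(x <- irange (z + m%:Z) n) H x.
  elim: m => [|m IH]; first by rewrite addr0.
  by rewrite IH step; congr (\sum_(x <- irange _ n) H x); lia.
case: (lerP s s') => h.
  by rewrite (pos `|s' - s|%N s); congr (\sum_(x <- irange _ n) H x); lia.
by rewrite [RHS](pos `|s' - s|%N s'); congr (\sum_(x <- irange _ n) H x); lia.
Qed.

Definition cg (a b : int) : bool := (n%:Z %| a - b)%Z.

Lemma cgP a b : reflect (exists y : int, a = b + y * n%:Z) (cg a b).
Proof.
apply: (iffP dvdzP) => [[y e]|[y e]]; exists y.
  by rewrite -e addrC subrK.
by rewrite e; ring.
Qed.

Lemma cg_refl a : cg a a.
Proof. by apply/cgP; exists 0; ring. Qed.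

Lemma cg_sym a b : cg a b = cg b a.
Proof. by apply/cgP/cgP => -[y ->]; exists (- y); ring. Qed.

Lemma cg_trans b a c : cg a b -> cg b c -> cg a c.
Proof. by move=> /cgP[y ->] /cgP[z ->]; apply/cgP; exists (y + z); ring. Qed.

Lemma cg_eql a b c : cg a b -> cg a c = cg b c.
Proof. by move=> h; apply/idP/idP; apply: cg_trans; rewrite // cg_sym. Qed.

Lemma cgD a b c : cg (a + c) (b + c) = cg a b.
Proof. by rewrite /cg; congr (_ %| _)%Z; ring. Qed.

Lemma cg_addn a : cg (a + n%:Z) a.
Proof. by apply/cgP; exists 1; ring. Qed.

Lemma cg_subn a : cg (a - n%:Z) a.
Proof. by apply/cgP; exists (-1); ring. Qed.

Lemma cg_move x a b : cg x a -> cg (x + (b - a)) b.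
Proof. by move=> /cgP[y ->]; apply/cgP; exists y; ring. Qed.

Lemma cg_small a b : cg a b -> `|a - b| < n%:Z -> a = b.
Proof.
move=> /cgP[y e] h; suff y0 : y = 0 by rewrite e y0; ring.
apply/eqP; apply: contraTT h => y0; rewrite -leNgt e.
have -> : b + y * n%:Z - b = y * n%:Z by ring.
by rewrite normrM; nia.
Qed.

Lemma cg_per a : periodic (cg^~ a).
Proof. by move=> x; rewrite (cg_eql _ (cg_addn x)). Qed.

Lemma sum_class (V : zmodType) (H : int -> V) s p :
  (0 < n)%N -> periodic H ->
  \sum_(x <- irange s n) (if cg x p then H x else 0) = H p.
Proof.
move=> n_gt0 pH; rewrite (@sum_window _ _ s p); last by move=> x; rewrite pH cg_per.
have -> : n = n.-1.+1 by lia.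
rewrite irangeS big_cons cg_refl big_seq big1 ?addr0 // => x; rewrite mem_irange => h.
by case: ifP => // /cg_small e; have := e ltac:(lia); lia.
Qed.

(** For incongruent [a] and [b], the affine reflection exchanging a + y n and b + y n for all y. For
    congruent arguments it merely shifts one class, hence the recurrent hypothesis [~~ cg a b]. *)
Definition tr (a b x : int) : int :=
  if cg x a then x + (b - a) else if cg x b then x + (a - b) else x.

Lemma tr_addn a b x : tr a b (x + n%:Z) = tr a b x + n%:Z.
Proof. by rewrite /tr !(cg_eql _ (cg_addn x)); do !case: ifP => _; ring. Qed.

Lemma tr_l a b : tr a b a = b.
Proof. by rewrite /tr cg_refl; ring. Qed.

Lemma tr_r a b : ~~ cg a b -> tr a b b = a.
Proof. by rewrite /tr cg_sym => /negPf ->; rewrite cg_refl; ring. Qed.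

Lemma tr_C a b : ~~ cg a b -> tr a b = tr b a.
Proof.
move=> h; apply/funext => x; rewrite /tr; case: (boolP (cg x a)) => // xa.
by rewrite (cg_eql _ xa) (negPf h).
Qed.

Lemma tr_shift a b y : tr (a + y * n%:Z) (b + y * n%:Z) = tr a b.
Proof.
have e c z : cg z (c + y * n%:Z) = cg z c.
  have h : cg (c + y * n%:Z) c by apply/cgP; exists y.
  by rewrite cg_sym (cg_eql _ h) cg_sym.
by apply/funext => x; rewrite /tr !e; do !case: ifP => _ //; ring.
Qed.

Lemma trK a b : ~~ cg a b -> involutive (tr a b).
Proof.
move=> h x; rewrite /tr; case: (boolP (cg x a)) => xa.
  rewrite (cg_eql _ (cg_move b xa)) cg_sym (negPf h) (cg_move b xa); ring.
case: (boolP (cg x b)) => xb; last by rewrite (negPf xa) (negPf xb).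
by rewrite (cg_move a xb); ring.
Qed.

(** Both products are the 3-cycle a -> b -> c -> a. *)
Lemma tr_conj a b c : ~~ cg a b -> ~~ cg b c -> ~~ cg a c ->
  tr a b \o tr b c = tr b c \o tr c a.
Proof.
move=> ab bc ac; apply/funext => x /=; rewrite /tr.
case: (boolP (cg x a)) => xa.
  have xab : cg x b = false by rewrite (cg_eql _ xa) (negPf ab).
  have xac : cg x c = false by rewrite (cg_eql _ xa) (negPf ac).
  rewrite xab xac xa (cg_eql b (cg_move c xa)) [cg c b]cg_sym (negPf bc) (cg_move c xa); ring.
case: (boolP (cg x b)) => xb.
  have xbc : cg x c = false by rewrite (cg_eql _ xb) (negPf bc).
  rewrite xbc xb (cg_eql a (cg_move c xb)) [cg c a]cg_sym (negPf ac).
  by rewrite (cg_eql b (cg_move c xb)) [cg c b]cg_sym (negPf bc).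
case: (boolP (cg x c)) => xc; last by rewrite (negPf xa) (negPf xb) (negPf xc).
rewrite (cg_eql a (cg_move b xc)) (cg_eql b (cg_move a xc)) (cg_eql c (cg_move a xc)).
rewrite [cg b a]cg_sym (negPf ab) (negPf ac) (cg_move b xc); ring.
Qed.

Lemma tr_comm a b c d : ~~ cg a c -> ~~ cg a d -> ~~ cg b c -> ~~ cg b d ->
  tr a b \o tr c d = tr c d \o tr a b.
Proof.
move=> ac ad bc bd; apply/funext => x /=; rewrite /tr.
case: (boolP (cg x a)) => xa.
  have xac : cg x c = false by rewrite (cg_eql _ xa) (negPf ac).
  have xad : cg x d = false by rewrite (cg_eql _ xa) (negPf ad).
  rewrite xac xad xa !(cg_eql _ (cg_move b xa)).
  by rewrite (negPf bc) (negPf bd).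
case: (boolP (cg x b)) => xb.
  have xac : cg x c = false by rewrite (cg_eql _ xb) (negPf bc).
  have xad : cg x d = false by rewrite (cg_eql _ xb) (negPf bd).
  rewrite xac xad xb !(cg_eql _ (cg_move a xb)) (negPf xa).
  by rewrite (negPf ac) (negPf ad).
case: (boolP (cg x c)) => xc.
  by rewrite !(cg_eql _ (cg_move d xc)) ![cg d _]cg_sym (negPf ad) (negPf bd).
case: (boolP (cg x d)) => xd; last by rewrite (negPf xa) (negPf xb).
by rewrite !(cg_eql _ (cg_move c xd)) ![cg c _]cg_sym (negPf ac) (negPf bc).
Qed.

Lemma tr_id a b x : ~~ cg x a -> ~~ cg x b -> tr a b x = x.
Proof. by rewrite /tr => /negPf -> /negPf ->. Qed.

End Reflections.

(** * Length of a bounded affine permutation *)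

Lemma irange_cat s M N : irange s (M + N) = irange s M ++ irange (s + M%:Z) N.
Proof.
rewrite /irange iotaD map_cat add0n; congr (_ ++ _).
rewrite -{1}[M]addn0 iotaDl -map_comp; apply: eq_map => x /=; lia.
Qed.

Section AffinePerms.
Variables (k n : nat).
Hypothesis n_gt0 : (0 < n)%N.

Local Notation cg := (cg n).
Local Notation tr := (tr n).
Local Notation per := (periodic n).

(** The conditions of [CB] that every reflection preserves, kept apart from boundedness, which a
    reflection may destroy. *)
Definition core (f : int -> int) :=
  affine_perm n f /\ \sum_(x <- irange 1 n) (f x - x) = (k * n)%N%:Z.

Definition bounded (f : int -> int) := forall i : int, i <= f i <= i + n%:Z.

Lemma CBE f : CB k n f <-> core f /\ bounded f.
Proof.
have e : \sum_(1 <= i < n.+1) (f i%:Z - i%:Z) = \sum_(x <- irange 1 n) (f x - x).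
  rewrite sum_irange_nat big_add1 big_mkord; apply: eq_bigr => i _.
  by congr (f _ - _); lia.
have n0 : n%:R != 0 :> rat by rewrite pnatr_eq0; lia.
rewrite /CB /core /= e; split => [[fa s b]|[[fa s] b]]; split => //.
  split=> //; apply: (@intr_inj rat).
  move: s => /(congr1 ( *%R n%:R)); rewrite mulrA divff // mul1r => ->.
  by rewrite -pmulrn natrM mulrC.
by rewrite s -pmulrn natrM mulrCA mulVf // mulr1.
Qed.

Lemma affine_shift f x y : affine_perm n f -> f (x + y * n%:Z) = f x + y * n%:Z.
Proof.
move=> [_ p]; have pH : per (fun z => f z - z) by move=> z; rewrite p; ring.
by rewrite -[LHS](subrK (x + y * n%:Z)) (periodicM y x pH); ring.
Qed.

Lemma affine_inj f : affine_perm n f -> injective f.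
Proof. by case=> /bij_inj. Qed.

Lemma affine_tr f a b : ~~ cg a b -> affine_perm n f -> affine_perm n (f \o tr a b).
Proof.
move=> ab [bf pf]; split=> [|i /=]; last by rewrite tr_addn pf.
by apply: bij_comp => //; apply: inv_bij; apply: trK.
Qed.

(** The displacement changes by f b - f a on the class of a and by the opposite on the class of b,
    and each class meets the window once. *)
Lemma core_tr f a b : ~~ cg a b -> core f -> core (f \o tr a b).
Proof.
move=> ab [fa s]; split; first exact: affine_tr.
rewrite -s; apply/eqP; rewrite -subr_eq0 -sumrB; apply/eqP.
pose H c d x := f (x + (d - c)) - f x.
have pH c d : per (H c d).
  move=> x; rewrite /H; case: fa => _ p.
  have -> : x + n%:Z + (d - c) = x + (d - c) + n%:Z by ring.
  by rewrite !p; ring.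
transitivity (\sum_(x <- irange 1 n) ((if cg x a then H a b x else 0) +
                                      (if cg x b then H b a x else 0))).
  apply: eq_bigr => x _; rewrite /= /tr /H.
  case: (boolP (cg x a)) => xa; first by rewrite (cg_eql _ xa) (negPf ab); ring.
  by case: ifP => _; ring.
have He c d : H c d c = f d - f c by rewrite /H [c + _]addrC subrK.
by rewrite big_split /= !sum_class // !He; ring.
Qed.

(** The product has value f b at a and f a at b, so its bounds include f b <= a + n and b <= f a;
    with a < b and f a < f b these bound [f] on both classes. *)
Lemma bounded_up f a b : ~~ cg a b -> affine_perm n f -> bounded (f \o tr a b) ->
  a < b -> f a < f b ->
  [/\ b <= f a, f b <= a + n%:Z & bounded f].
Proof.
move=> ab fa bg lab lfab.
have /andP[ga ga'] := bg a; have /andP[gb gb'] := bg b.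
move: ga ga' gb gb'; rewrite /= tr_l tr_r // => ga ga' gb gb'.
split => // i; have := bg i; rewrite /= /tr.
case: ifP => [/cgP[y ->]|ia].
  have -> : a + y * n%:Z + (b - a) = b + y * n%:Z by ring.
  by rewrite !affine_shift //; lia.
case: ifP => [/cgP[y ->]|ib] //.
have -> : b + y * n%:Z + (a - b) = a + y * n%:Z by ring.
by rewrite !affine_shift //; lia.
Qed.

(** For bounded [f] an inversion (a, a + d) has d < n, since f (a + d) >= a + d and f a <= a + n;
    this finite count is then the length. *)
Definition ilen (f : int -> int) : int :=
  \sum_(a <- irange 1 n) \sum_(d <- irange 1 n.-1) (nat_of_bool (f (a + d) < f a))%:Z.

(* Each arc having exactly one end in the periodic set [s] is counted from that
   end. *)
Lemma arc_split (V : zmodType) (s : int -> bool) (Psi : int -> int -> V) :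
  per s -> (forall a b, Psi a b = Psi b a) ->
  (forall a b, Psi (a + n%:Z) (b + n%:Z) = Psi a b) ->
  \sum_(a <- irange 1 n) \sum_(d <- irange 1 n.-1)
     (if s a != s (a + d) then Psi a (a + d) else 0) =
  \sum_(a <- irange 1 n) (if s a then \sum_(d <- irange (1 - n%:Z) (n.-1 + n))
     (if s (a + d) then 0 else Psi a (a + d)) else 0).
Proof.
move=> ps PsiC Psin.
transitivity (\sum_(a <- irange 1 n) \sum_(d <- irange 1 n.-1)
    (if s a && ~~ s (a + d) then Psi a (a + d) else 0) +
   \sum_(a <- irange 1 n) \sum_(d <- irange 1 n.-1)
    (if ~~ s a && s (a + d) then Psi a (a + d) else 0)).
  rewrite -big_split; apply: eq_bigr => a _; rewrite -big_split; apply: eq_bigr => d _.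
  by case: (s a); case: (s (a + d)); rewrite /= ?addr0 ?add0r.
rewrite [X in _ + X]exchange_big /=.
pose F d x := if ~~ s (x - d) && s x then Psi (x - d) x else 0.
rewrite [X in _ + X](eq_bigr (fun d => \sum_(a <- irange 1 n) F d a)); last first.
  move=> d _; rewrite (eq_bigr (fun a => F d (a + d))); last by move=> a _; rewrite /F addrK.
  rewrite sum_irange_shift; apply: sum_window => x; rewrite /F.
  have -> : x + n%:Z - d = x - d + n%:Z by ring.
  by rewrite !ps Psin.
rewrite /F {F}.
rewrite [X in _ + X]exchange_big /= -big_split /=; apply: eq_bigr => a _.
case: (boolP (s a)) => sa /=; last by rewrite !big1 ?addr0 // => d _; rewrite andbF.
have -> : (n.-1 + n = n.-1 + n.-1.+1)%N by lia.
rewrite irange_cat big_cat /= addrC; congr (_ + _).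
  pose F x := if s (a + x) then 0 else Psi a (a + x).
  rewrite (eq_bigr (fun d => F (- d))); last first.
    by move=> d _; rewrite /F andbT; case: (s _) => //=; rewrite PsiC.
  by rewrite sum_irange_opp; congr (\sum_(x <- irange _ _) F x); lia.
have -> : 1 - n%:Z + n.-1%:Z = 0 by lia.
rewrite irangeS big_cons !addr0 sa add0r; apply: eq_bigr => d _.
by rewrite if_neg.
Qed.

Lemma sum_pair_class (V : zmodType) (H : int -> V) p q : ~~ cg p q -> per H ->
  \sum_(a <- irange 1 n) (if cg a p || cg a q then H a else 0) = H p + H q.
Proof.
move=> pq pH; rewrite -(@sum_class n _ H 1 p n_gt0 pH) -(@sum_class n _ H 1 q n_gt0 pH).
rewrite -big_split; apply: eq_bigr => a _ /=.
case: (boolP (cg a p)) => ap /=; last by rewrite add0r.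
by rewrite (cg_eql _ ap) (negPf pq) addr0.
Qed.

(** Unlike the inversion indicator, this is symmetric in [x] and [y] for injective [f], as
    [arc_split] requires. *)
Definition disc (f : int -> int) (x y : int) : int :=
  (nat_of_bool ((x < y) != (f x < f y)))%:Z.

Lemma disc_far f x y : injective f -> bounded f -> n%:Z <= `|x - y| -> disc f x y = 0.
Proof.
move=> fI bf h; have fxy : f x != f y by apply/eqP => /fI; lia.
by rewrite /disc; have := bf x; have := bf y; lia.
Qed.

Definition between (f : int -> int) p q b := (p < b < q) && (f p < f b < f q).

Lemma cg_mid p q b : p < q < p + n%:Z -> p < b < q -> cg b p || cg b q = false.
Proof.
move=> h hb; apply/negbTE/negP => /orP[] /cg_small e; have := e ltac:(lia); lia.
Qed.

(** Only pairs with an end in the class of p or q can change. The pair (p, q) adds 1. For any other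
    b, the changes of its pairs with p and with q sum to 2 if b lies between them in position and in
    value, and to 0 otherwise. *)
Lemma ilen_tr f p q : ~~ cg p q -> affine_perm n f -> bounded (f \o tr p q) ->
  p < q -> f p < f q ->
  ilen (f \o tr p q) = ilen f + 1 +
    2 * \sum_(b <- irange p `|q - p|) (nat_of_bool (between f p q b))%:Z.
Proof.
move=> pq fa bg lpq lf; set g := f \o tr p q.
have [h1 h2 bf] := bounded_up pq fa bg lpq lf.
have fI := affine_inj fa; have ga : affine_perm n g := affine_tr pq fa; have gI := affine_inj ga.
pose s x := cg x p || cg x q.
have ps : per s by move=> x; rewrite /s !(cg_per _).
pose Psi a b := disc g a b - disc f a b.
have gs x : ~~ s x -> g x = f x by rewrite /g /= negb_or => /andP[xp xq]; rewrite tr_id.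
have gp : g p = f q by rewrite /g /= tr_l.
have gq : g q = f p by rewrite /g /= tr_r.
have discC (h : int -> int) a b : injective h -> disc h a b = disc h b a.
  move=> hI; rewrite /disc; have [->//|ab] := eqVneq a b.
  have hab : h a != h b by apply: contra ab => /eqP/hI ->.
  lia.
have PsiC a b : Psi a b = Psi b a by rewrite /Psi discC // [disc f _ _]discC.
have Psin a b : Psi (a + n%:Z) (b + n%:Z) = Psi a b.
  by rewrite /Psi /disc; case: fa => _ pf; case: ga => _ pg; rewrite !pf !pg !ltrD2r.
have E : ilen g - ilen f = \sum_(a <- irange 1 n) \sum_(d <- irange 1 n.-1) Psi a (a + d).
  rewrite /ilen -sumrB; apply: eq_bigr => a _; rewrite -sumrB big_seq [RHS]big_seq.
  apply: eq_bigr => d; rewrite mem_irange => hd; rewrite /Psi /disc.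
  have hf (h : int -> int) : injective h -> h a != h (a + d) by move=> hI; apply/eqP => /hI; lia.
  have := hf _ fI; have := hf _ gI; lia.
(* Among pairs with both ends in the classes of p and q, the translates of (p, q) become inverted,
   while those of (q, p + n) keep their order because q <= f p and f q <= p + n. *)
have {}E : ilen g - ilen f =
    (\sum_(a <- irange 1 n) \sum_(d <- irange 1 n.-1)
        (if s a != s (a + d) then Psi a (a + d) else 0)) +
    (\sum_(a <- irange 1 n) (if cg a p then 1 else 0)).
  rewrite E -big_split; apply: eq_bigr => a _ /=.
  transitivity (\sum_(d <- irange 1 n.-1) ((if s a != s (a + d) then Psi a (a + d) else 0)
      + (if cg a p then (if d == q - p then 1 else 0) else 0))).
    rewrite big_seq [RHS]big_seq; apply: eq_bigr => d; rewrite mem_irange => hd.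
    case: (boolP (s a)) => sa; case: (boolP (s (a + d))) => sd /=.
    - rewrite add0r; case/orP: sa => /cgP[y ya].
        have ap : cg a p by apply/cgP; exists y.
        rewrite ap; have e : d = q - p.
          have [/cgP[z e]|/cgP[z e]] := orP sd.
            have c : cg (a + d) a by rewrite cg_sym (cg_eql _ ap) cg_sym; apply/cgP; exists z.
            by have := cg_small c ltac:(lia); lia.
          have := @cg_small n d (q - p) => -> //; last lia.
          by apply/cgP; exists (z - y); lia.
        have -> : (d == q - p) by apply/eqP.
        have -> : a + d = q + y * n%:Z by lia.
        by rewrite ya /Psi /disc !affine_shift // gp gq; lia.
      have aq : cg a q by apply/cgP; exists y.
      have ap : cg a p = false by rewrite (cg_eql _ aq) cg_sym (negPf pq).
      rewrite ap.
      have e : d = p - q + n%:Z.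
        have [/cgP[z e]|/cgP[z e]] := orP sd.
          have := @cg_small n d (p - q + n%:Z) => -> //; last lia.
          by apply/cgP; exists (z - y - 1); lia.
        have c : cg (a + d) a by rewrite cg_sym (cg_eql _ aq) cg_sym; apply/cgP; exists z.
        by have := cg_small c ltac:(lia); lia.
      have -> : a + d = p + (y + 1) * n%:Z by lia.
      by rewrite ya /Psi /disc !affine_shift // gp gq; lia.
    - case: ifP => ap; last by rewrite addr0.
      case: eqP => [e|]; last by rewrite addr0.
      case/cgP: ap => y ya; case/negP: sd; rewrite /s; apply/orP; right.
      by apply/cgP; exists y; lia.
    - by case: ifP => ap; rewrite ?addr0 //; case/negP: sa; rewrite /s ap.
    - rewrite add0r; case: ifP => ap; first by case/negP: sa; rewrite /s ap.
      by rewrite /Psi /disc !gs // subrr.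
  rewrite big_split; congr (_ + _); case: ifP => _; last by rewrite big1.
  rewrite (@eq_big_supp _ _ _ [:: q - p]) ?irange_uniq //; first by rewrite big_seq1 eqxx.
  by move=> x; case: (eqVneq x (q - p)) => // -> _; rewrite mem_irange inE eqxx; lia.
have pc : per (fun=> 1 : int) by [].
suff M : \sum_(a <- irange 1 n) \sum_(d <- irange 1 n.-1)
        (if s a != s (a + d) then Psi a (a + d) else 0) =
  2 * \sum_(b <- irange p `|q - p|) (nat_of_bool (between f p q b))%:Z.
  by move: E; rewrite M (@sum_class n _ (fun=> 1 : int) 1 p n_gt0 pc); lia.
rewrite arc_split //; pose H a := \sum_(d <- irange (1 - n%:Z) (n.-1 + n))
   (if s (a + d) then 0 else Psi a (a + d)).
have pH : per H.
  move=> x; apply: eq_bigr => d _.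
  have -> : x + n%:Z + d = x + d + n%:Z by ring.
  by rewrite ps Psin.
rewrite (@sum_pair_class _ H) // /H.
(* For a in [p, q], where q < p + n, every b at distance less than n from a lies in [p - n, p +
   2n). *)
pose B := irange (p - n%:Z) (3 * n).
have wide a : p <= a <= q -> \sum_(d <- irange (1 - n%:Z) (n.-1 + n))
   (if s (a + d) then 0 else Psi a (a + d)) = \sum_(b <- B) (if s b then 0 else Psi a b).
  move=> ha; pose F b := if s b then 0 else Psi a b.
  rewrite (eq_bigr (fun d => F (d + a))); last by move=> d _; rewrite /F [d + a]addrC.
  rewrite sum_irange_shift /F.
  apply: eq_big_supp; rewrite ?irange_uniq // => x; case: ifP => // _ hx.
  have : `|a - x| < n%:Z.
    by rewrite ltNge; apply: contra hx => hx; rewrite /Psi !disc_far.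
  by rewrite !mem_irange; lia.
rewrite !wide ?lexx ?ltW // -big_split mulr_sumr.
transitivity (\sum_(b <- B) 2 * (nat_of_bool (between f p q b))%:Z).
  apply: eq_bigr => b _ /=; case: ifP => sb.
    rewrite /between; case: (boolP (p < b < q)) => // hb.
    by rewrite /s cg_mid // in sb; lia.
  have := gs b; rewrite sb /Psi /disc /between gp gq => -> //.
  have bp : f b != f p by apply/eqP => /fI e; move: sb; rewrite /s e cg_refl.
  have bq : f b != f q by apply/eqP => /fI e; move: sb; rewrite /s e cg_refl orbT.
  have bp' : b != p by apply/eqP => e; move: sb; rewrite /s e cg_refl.
  have bq' : b != q by apply/eqP => e; move: sb; rewrite /s e cg_refl orbT.
  lia.
apply: eq_big_supp; rewrite ?irange_uniq // => b hb.
by rewrite !mem_irange; move: hb; rewrite /between; lia.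
Qed.

End AffinePerms.

(** * Covers and brackets *)

Lemma card_fset_set_seq (T : choiceType) (s : seq T) (A : set T) :
  uniq s -> A = [set` s] -> #|` fset_set A| = size s.
Proof.
move=> us ->; have -> : [set` s] = [set` [fset x in s]%fset].
  by apply/seteqP; split => x /=; rewrite !inE.
by rewrite set_fsetK card_fseq undup_id.
Qed.

Section Covers.
Variables (k n : nat).
Hypothesis n_gt0 : (0 < n)%N.

Local Notation cg := (cg n).
Local Notation tr := (tr n).
Local Notation per := (periodic n).
Local Notation core := (core k n).
Local Notation bounded := (bounded n).
Local Notation ilen := (ilen n).

Lemma window_rep (x : int) : exists r : int, 1 <= x - r * n%:Z <= n%:Z.
Proof.
exists ((x - 1) %/ n%:Z)%Z; have := divz_eq (x - 1) n%:Z.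
have := modz_ge0 (x - 1) (d := n%:Z); have := ltz_pmod (x - 1) (d := n%:Z).
by move=> h1 h2; have := h1 ltac:(lia); have := h2 ltac:(lia); lia.
Qed.

(** Each class of inversions has exactly one representative with first entry in [1, n], so the
    classes form an explicit list without repetition; in particular their set is finite. *)
Lemma aff_lengthE f : affine_perm n f -> bounded f -> (aff_length n f)%:Z = ilen f.
Proof.
move=> fa bf; have fI := affine_inj fa.
pose ps : seq (int * int) := [seq (a, a + d) | a <- irange 1 n, d <- irange 1 n.-1].
pose l := [seq p <- ps | f p.2 < f p.1].
have ups : uniq ps.
  apply: allpairs_uniq; rewrite ?irange_uniq // => -[a d] [a' d'] _ _ /= [-> h].
  by congr (_, _); lia.
have memps (x y : int) : ((x, y) \in ps) = (1 <= x <= n%:Z) && (1 <= y - x < n%:Z).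
  apply/allpairsP/idP => [[[a d] /= [+ + [-> ->]]]|h].
    by rewrite !mem_irange /=; lia.
  exists (x, y - x); rewrite !mem_irange /=; split; [lia|lia|].
  by rewrite addrC subrK.
have size_l : (size l)%:Z = ilen f.
  rewrite /l size_filter -sum1_count big_mkcond /= big_allpairs_dep /=.
  rewrite (big_morph Posz (id1 := 0) (op1 := +%R)) //=; apply: eq_bigr => a _.
  rewrite (big_morph Posz (id1 := 0) (op1 := +%R)) //=; apply: eq_bigr => d _.
rewrite -size_l /aff_length -(size_map (shift_class n)); congr Posz.
apply: card_fset_set_seq.
  rewrite map_inj_in_uniq; first exact: filter_uniq.
  move=> [x y] [x' y']; rewrite !mem_filter !memps /= => /andP[_ h] /andP[_ h'] e.
  have : shift_class n (x, y) (x, y) by exists 0; rewrite /= !mul0r !addr0.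
  rewrite e => -[r /= [e1 e2]].
  have r0 : x = x'.
    by apply: (@cg_small n); [apply/cgP; exists r|lia].
  by congr (_, _) => //; lia.
apply/seteqP; split => [_ [[x y] /= [lxy fxy] <-]|C /mapP[[x y]]].
  have [r hr] := window_rep x.
  apply/mapP; exists (x - r * n%:Z, y - r * n%:Z).
    rewrite mem_filter memps /=.
    have e z : z - r * n%:Z = z + (- r) * n%:Z by ring.
    rewrite (e x) (e y) !(affine_shift _ _ fa) ltrD2r fxy /=.
    move: lxy fxy (bf x) (bf y) => /=; lia.
  apply/seteqP; split => -[u v] [t /= [-> ->]].
    by exists (t + r); congr (_, _) => /=; ring.
  by exists (t - r); congr (_, _) => /=; ring.
rewrite mem_filter memps => /andP[fp hp] ->; exists (x, y) => //.
by split => //=; lia.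
Qed.

(** * Ascents, covers and two-step chains *)

Definition up (f : int -> int) a b := ~~ cg a b && ((a < b) == (f a < f b)).

Lemma upC f a b : injective f -> up f a b = up f b a.
Proof.
move=> fI; rewrite /up cg_sym; case: (boolP (cg b a)) => //= ab.
have nab : a != b by apply: contra ab => /eqP ->; rewrite cg_refl.
have fab : f a != f b by apply: contra nab => /eqP/fI ->.
by lia.
Qed.

Lemma up_len f a b : affine_perm n f -> up f a b -> bounded (f \o tr a b) ->
  bounded f /\ ilen f + 1 <= ilen (f \o tr a b).
Proof.
move=> fa; have fI := affine_inj fa.
have main (c d : int) : c < d -> up f c d -> bounded (f \o tr c d) ->
  bounded f /\ ilen f + 1 <= ilen (f \o tr c d).
  move=> lcd /andP[cd]; rewrite lcd eq_sym eqb_id => lf bg.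
  have [_ _ bf] := bounded_up n_gt0 cd fa bg lcd lf; split=> //.
  by rewrite (ilen_tr n_gt0 cd fa bg lcd lf) lerDl mulr_ge0 // sumr_ge0.
case: (ltgtP a b) => [|ba|->]; first exact: main.
  move=> u; have ab : ~~ cg a b by case/andP: u.
  by rewrite tr_C //; apply: main => //; rewrite upC.
by rewrite /up cg_refl.
Qed.

(** Symmetric in [a] and [b] for affine [f], so that the direction of an arc enters the brackets
    only as a sign. *)
Definition cv (f : int -> int) a b :=
  [&& up f a b, `[< bounded (f \o tr a b) >] & ilen (f \o tr a b) == ilen f + 1].

Lemma cvC f a b : affine_perm n f -> cv f a b = cv f b a.
Proof.
move=> fa; rewrite /cv (@upC _ _ _ (affine_inj fa)); case: (boolP (up f b a)) => //= u.
by rewrite (@tr_C n a b) // cg_sym; case/andP: u.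
Qed.

Lemma cv_shift f a b y : affine_perm n f -> cv f (a + y * n%:Z) (b + y * n%:Z) = cv f a b.
Proof.
by move=> fa; rewrite /cv tr_shift /up !affine_shift // cgD !ltrD2r.
Qed.

Lemma cv_ncg f a b : cv f a b -> ~~ cg a b.
Proof. by case/and3P => /andP[]. Qed.

Lemma cv_bounds f a b : affine_perm n f -> cv f a b -> a < b ->
  [/\ b <= f a, f a < f b & f b <= a + n%:Z].
Proof.
move=> fa /and3P[/andP[ab u] /asboolP bg _] lab.
have lf : f a < f b by rewrite lab in u; rewrite -(eqP u).
by have [] := bounded_up n_gt0 ab fa bg lab lf.
Qed.

Lemma cv_affine f a b : affine_perm n f -> cv f a b -> affine_perm n (f \o tr a b).
Proof. by move=> fa /cv_ncg ab; apply: affine_tr. Qed.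

(** A bounded end forces a bounded middle, and two ascents that add at least 1 each and 2 together
    add exactly 1 each. *)
Lemma cv2E f a b c d : affine_perm n f ->
  cv f a b && cv (f \o tr a b) c d =
  [&& up f a b, up (f \o tr a b) c d, `[< bounded (f \o tr a b \o tr c d) >]
    & ilen (f \o tr a b \o tr c d) == ilen f + 2].
Proof.
move=> fa; apply/andP/and4P => [[/and3P[u1 _ /eqP l1] /and3P[u2 b2 /eqP l2]]|].
  by split => //; rewrite l2 l1 -addrA.
move=> [u1 u2 b2 /eqP l2].
have ga : affine_perm n (f \o tr a b) by apply: affine_tr => //; case/andP: u1.
have [b1 L2] := up_len ga u2 (asboolW b2).
have [b0 L1] := up_len fa u1 b1.
by split; apply/and3P; split => //; try exact/asboolP; apply/eqP; lia.
Qed.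

(** Up to symmetry and shift the second pair is (a, b + M) with M a multiple of n. The inequalities
    of [cv_bounds] at the two steps exclude M = 0, M >= n and M <= -n. *)
Lemma cv2_same f a b c d : affine_perm n f ->
  (cg a c && cg b d) || (cg a d && cg b c) -> cv f a b && cv (f \o tr a b) c d = false.
Proof.
move=> fa; apply: contraTF => /andP[v1 v2]; have ab := cv_ncg v1.
have ga := cv_affine fa v1.
have main b' : cg b' b -> ~~ cv (f \o tr a b) a b'.
  move=> /cgP[m e]; apply/negP => v3.
  have ab' := cv_ncg v3.
  have ga' : (f \o tr a b) a = f b by rewrite /= tr_l.
  have gb' : (f \o tr a b) b' = f a + m * n%:Z.
    by rewrite e (affine_shift _ _ ga) /= tr_r.
  have hM : [\/ m * n%:Z = 0, n%:Z <= m * n%:Z | m * n%:Z <= - n%:Z].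
    have [m0|[m0|m0]] : m = 0 \/ (1 <= m \/ m <= -1) by lia.
    - by apply: Or31; rewrite m0 mul0r.
    - by apply: Or32; nia.
    - by apply: Or33; nia.
  have nab : a != b by apply: contra ab => /eqP ->; rewrite cg_refl.
  have nab' : a != b' by apply: contra ab' => /eqP ->; rewrite cg_refl.
  move: gb' e hM; set M := m * n%:Z => gb' e hM.
  have B1 := cv_bounds fa v1; have B3 := cv_bounds ga v3.
  have B1' : b < a -> _ := cv_bounds fa (etrans (cvC _ _ fa) v1).
  have B3' : b' < a -> _ := cv_bounds ga (etrans (cvC _ _ ga) v3).
  rewrite ga' gb' in B3 B3'.
  have [l1|l1|] := ltgtP a b; last by move/eqP: nab.
    have {B1'} [? ? ?] := B1 l1.
    have [l3|l3|] := ltgtP a b'; last by move/eqP: nab'.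
      by have [? ? ?] := B3 l3; case: hM => ?; lia.
    by have [? ? ?] := B3' l3; case: hM => ?; lia.
  have {B1} [? ? ?] := B1' l1.
  have [l3|l3|] := ltgtP a b'; last by move/eqP: nab'.
    by have [? ? ?] := B3 l3; case: hM => ?; lia.
  by have [? ? ?] := B3' l3; case: hM => ?; lia.
have main2 c' d' : cg a c' && cg b d' -> ~~ cv (f \o tr a b) c' d'.
  case/andP; rewrite cg_sym => /cgP[y ->] bd.
  have -> : d' = d' - y * n%:Z + y * n%:Z by ring.
  rewrite cv_shift //; apply: main; rewrite cg_sym; apply: cg_trans bd _.
  by apply/cgP; exists y; ring.
rewrite negb_or; apply/andP; split; first by apply: contraL v2; apply: main2.
by apply: contraL v2; rewrite cvC //; apply: main2.
Qed.

Section Brackets.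
Variables (R : comNzRingType) (phi : (int -> int) -> R).

(* [sgc f a b] is the coefficient of the signed bracket [a b], which maps f to
   the cover f t_ab; brackets are antisymmetric in a and b. *)
Definition sgc f a b : R := if cv f a b then (if a < b then 1 else -1) else 0.

(** The term of [a b] followed by [c d] at [f], evaluated by [phi] at the end of the two-step path;
    commutators are expanded into such terms. *)
Definition K f a b c d : R :=
  sgc f a b * sgc (f \o tr a b) c d * phi (f \o tr a b \o tr c d).

Lemma sgcC f a b : affine_perm n f -> sgc f a b = - sgc f b a.
Proof.
move=> fa; rewrite /sgc (cvC _ _ fa); case: ifP => [/cv_ncg|_]; last by rewrite oppr0.
have [| |->] := ltgtP a b; rewrite ?opprK //; last by rewrite cg_refl.
Qed.

Lemma KE f a b c d : affine_perm n f -> K f a b c d =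
  if cv f a b && cv (f \o tr a b) c d then
   (if a < b then 1 else -1) * (if c < d then 1 else -1) * phi (f \o tr a b \o tr c d)
  else 0.
Proof.
move=> fa; rewrite /K /sgc; case: (cv f a b); last by rewrite !mul0r.
by case: (cv (f \o _) c d) => //=; rewrite mulr0 mul0r.
Qed.

Lemma KCl f a b c d : affine_perm n f -> K f a b c d = - K f b a c d.
Proof.
move=> fa; rewrite /K sgcC //; have [/cv_ncg ab|v] := boolP (cv f b a).
  by rewrite (tr_C ab) !mulNr.
by rewrite /sgc (negPf v) oppr0 !mul0r oppr0.
Qed.

Lemma KCr f a b c d : affine_perm n f -> K f a b c d = - K f a b d c.
Proof.
move=> fa; rewrite !KE //; have [/cv_ncg ab|v] := boolP (cv f a b); last by rewrite oppr0.
have ga := affine_tr ab fa; rewrite /= (cvC _ _ ga).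
case: ifP => [/cv_ncg cd|_]; last by rewrite oppr0.
rewrite (tr_C cd); case: (ltgtP c d) => [_|_|e] /=; [ring|ring|].
by rewrite e cg_refl in cd.
Qed.

Lemma K_same f a b c d : affine_perm n f ->
  (cg a c && cg b d) || (cg a d && cg b c) -> K f a b c d = 0.
Proof. by move=> fa h; rewrite KE // cv2_same. Qed.

Lemma K_comm f a b c d : affine_perm n f ->
  ~~ cg a c -> ~~ cg a d -> ~~ cg b c -> ~~ cg b d ->
  K f a b c d = K f c d a b.
Proof.
move=> fa ac ad bc bd; rewrite !KE // !cv2E //.
have e : f \o tr a b \o tr c d = f \o tr c d \o tr a b.
  exact: (congr1 (comp f) (tr_comm ac ad bc bd)).
rewrite e; have e1 : up (f \o tr a b) c d = up f c d.
  by rewrite /up /= !tr_id // cg_sym.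
have e2 : up (f \o tr c d) a b = up f a b by rewrite /up /= !tr_id.
by rewrite e1 e2 andbCA; case: ifP => // _; ring.
Qed.

(* The three-term relation [ab][bc] + [bc][ca] + [ca][ab] = 0 of the
   Fomin-Kirillov algebra. All three products of reflections agree, and a
   two-step chain only requires two ascents and total length increase 2. *)
Lemma K_cycle f a b c : affine_perm n f ->
  ~~ cg a b -> ~~ cg b c -> ~~ cg c a ->
  K f a b b c + K f b c c a + K f c a a b = 0.
Proof.
move=> fa ab bc ca; have fI := affine_inj fa.
have ba : ~~ cg b a by rewrite cg_sym.
have cb : ~~ cg c b by rewrite cg_sym.
have ac : ~~ cg a c by rewrite cg_sym.
have e1 : f \o tr b c \o tr c a = f \o tr a b \o tr b c.
  exact: (congr1 (comp f) (esym (tr_conj ab bc ac))).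
have e2 : f \o tr c a \o tr a b = f \o tr a b \o tr b c.
  by rewrite -e1; exact: (congr1 (comp f) (esym (tr_conj bc ca ba))).
rewrite !KE // !cv2E // e1 e2; case: (`[< _ >] && _); last by rewrite !andbF !addr0.
rewrite !andbT; have ne x y : ~~ cg x y -> (x != y) && (f x != f y).
  move=> xy; have nxy : x != y by apply: contra xy => /eqP ->; rewrite cg_refl.
  by rewrite nxy; apply: contra nxy => /eqP/fI ->.
have /andP[n1 m1] := ne _ _ ab; have /andP[n2 m2] := ne _ _ bc.
have /andP[n3 m3] := ne _ _ ca; rewrite /up ab bc ca /= !tr_r // !tr_id //.
(* Around the cycle a, b, c the comparisons are neither all true nor all false, for positions as for
   values; the relation is then checked on each remaining pattern. *)
have x : ~~ [&& a < b, b < c & c < a] && [|| a < b, b < c | c < a] by lia.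
have y : ~~ [&& f a < f b, f b < f c & f c < f a] &&
         [|| f a < f b, f b < f c | f c < f a] by lia.
have -> : (f a < f c) = ~~ (f c < f a) by lia.
have -> : (f b < f a) = ~~ (f a < f b) by lia.
have -> : (f c < f b) = ~~ (f b < f c) by lia.
move: (phi _) (a < b) (b < c) (c < a) (f a < f b) (f b < f c) (f c < f a) x y => t.
by case; case; case; case; case; case => //= _ _; ring.
Qed.

End Brackets.

End Covers.

(** * Dunkl and Chevalley operators *)

Section Operators.
Variable n : nat.
Hypothesis n_gt0 : (0 < n)%N.
Variable R : comNzRingType.

Local Notation cg := (cg n).
Local Notation tr := (tr n).
Local Notation per := (periodic n).
Local Notation cv := (cv n).
Local Notation sgc := (sgc n R).

Lemma cv_near f a b : affine_perm n f -> cv f a b -> `|a - b| < n%:Z.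
Proof.
move=> fa v; have := cv_bounds n_gt0 fa v.
have := cv_bounds n_gt0 fa (etrans (cvC n_gt0 b a fa) v).
have [l|l|->] := ltgtP a b => B1 B2; last lia.
  by have [] := B2 isT; lia.
by have [] := B1 isT; lia.
Qed.

Lemma sgc_near f a b : affine_perm n f -> sgc f a b != 0 -> `|a - b| < n%:Z.
Proof. by move=> fa; rewrite /sgc; case: ifP => [/(cv_near fa) //|_]; rewrite eqxx. Qed.

Lemma sgc_shift f a b y : affine_perm n f ->
  sgc f (a + y * n%:Z) (b + y * n%:Z) = sgc f a b.
Proof. by move=> fa; rewrite /sgc cv_shift // ltrD2r. Qed.

Lemma sgc_cg f a b : cg a b -> sgc f a b = 0.
Proof. by move=> ab; rewrite /sgc /cv /up ab. Qed.

Definition edge (phi : (int -> int) -> R) f a b := sgc f a b * phi (f \o tr a b).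

Lemma edgeC phi f a b : affine_perm n f -> edge phi f a b = - edge phi f b a.
Proof.
move=> fa; rewrite /edge sgcC //; have [ab|ab] := boolP (cg b a).
  by rewrite sgc_cg // oppr0 !mul0r oppr0.
by rewrite (tr_C ab) mulNr.
Qed.

Lemma edge_shift phi f a b y : affine_perm n f ->
  edge phi f (a + y * n%:Z) (b + y * n%:Z) = edge phi f a b.
Proof. by move=> fa; rewrite /edge sgc_shift // tr_shift. Qed.

Lemma edge_shift1 phi f a b : affine_perm n f ->
  edge phi f (a + n%:Z) (b + n%:Z) = edge phi f a b.
Proof. by move=> fa; rewrite -[RHS](edge_shift phi a b 1 fa) !mul1r. Qed.

(* The Dunkl element sum_q [p q]; its range covers every q with [p q] <> 0. *)
Definition dunkl (phi : (int -> int) -> R) p f : R :=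
  \sum_(q <- irange (p - 2 * n%:Z) (4 * n)) edge phi f p q.

Variable lam : int -> R.
Variable A : R.
Hypothesis lamn : forall x, lam (x + n%:Z) = lam x + A.

Definition chev (phi : (int -> int) -> R) f : R :=
  \sum_(a <- irange 1 n) \sum_(d <- irange 1 n.-1)
    (lam (a + d) - lam a) * edge phi f a (a + d).

(* Brackets with disjoint supports commute and those with equal supports
   vanish, so only pairs sharing the class of p or q survive in the commutator;
   exchanging q and z groups them into three-term relations. *)
Lemma dunkl_chev phi p f : affine_perm n f ->
  dunkl (chev phi) p f = chev (dunkl phi p) f.
Proof.
move=> fa; pose w a b := lam b - lam a.
(* Nonzero terms have |p - q| < n and, for an arc from q to z, |q - z| < n, so z stays within 2n of
   p. One range for both q and z makes their exchange possible. *)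
pose Z := irange (p - 2 * n%:Z) (4 * n).
pose KK := K n phi f.
have Kfar a b c d : KK a b c d != 0 -> (`|a - b| < n%:Z) && (`|c - d| < n%:Z).
  rewrite /KK KE //; case: ifP => [/andP[v1 v2] _|_]; last by rewrite eqxx.
  by rewrite (cv_near fa v1) (cv_near (cv_affine fa v1) v2).
have Ksh1 a b c d : KK (a + n%:Z) (b + n%:Z) c d = KK a b c d.
  rewrite /KK /K.
  have -> : tr (a + n%:Z) (b + n%:Z) = tr a b by rewrite -[RHS](tr_shift n a b 1) !mul1r.
  have -> : sgc f (a + n%:Z) (b + n%:Z) = sgc f a b.
    by rewrite -[RHS](sgc_shift a b 1 fa) !mul1r.
  by [].
have Ksh2 a b c d : KK a b (c + n%:Z) (d + n%:Z) = KK a b c d.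
  rewrite /KK !KE //; have -> : tr (c + n%:Z) (d + n%:Z) = tr c d.
    by rewrite -[RHS](tr_shift n c d 1) !mul1r.
  rewrite ltrD2r; case: (boolP (cv f a b)) => //= v1.
  by rewrite -(cv_shift c d 1 (cv_affine fa v1)) !mul1r.
have Kcg1 a b c d : cg a b -> KK a b c d = 0.
  by move=> ab; rewrite /KK /K sgc_cg // !mul0r.
have Kcg2 a b c d : cg c d -> KK a b c d = 0.
  by move=> ab; rewrite /KK /K [X in _ * X * _]sgc_cg // mulr0 mul0r.
pose Psi q a b := w a b * (KK p q a b - KK a b p q).
have PsiC q a b : Psi q a b = Psi q b a.
  by rewrite /Psi /KK (KCr n_gt0 phi p q a b fa) (KCl n_gt0 phi a b p q fa) /w; ring.
have Psin q a b : Psi q (a + n%:Z) (b + n%:Z) = Psi q a b.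
  by rewrite /Psi Ksh1 Ksh2 /w !lamn; congr (_ * _); ring.
have Psifar q a b : Psi q a b != 0 -> (`|a - b| < n%:Z) && (`|p - q| < n%:Z).
  rewrite /Psi; have [->|k1] := eqVneq (KK p q a b) 0; last by move=> _; have := Kfar _ _ _ _ k1; lia.
  have [->|k2] := eqVneq (KK a b p q) 0; last by move=> _; have := Kfar _ _ _ _ k2; lia.
  by rewrite subr0 mulr0 eqxx.
have Psis q a b : (cg a p || cg a q) = (cg b p || cg b q) -> Psi q a b = 0.
  have [pq|pq] := boolP (cg p q).
    by move=> _; rewrite /Psi (Kcg1 p q a b pq) (Kcg2 a b p q pq) subrr mulr0.
  have [ab|ab] := boolP (cg a b).
    by move=> _; rewrite /Psi (Kcg1 a b p q ab) (Kcg2 p q a b ab) subrr mulr0.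
  have [sa|] := boolP (cg a p || cg a q).
    move=> /esym sb; rewrite /Psi; suff [-> ->] : KK p q a b = 0 /\ KK a b p q = 0.
      by rewrite subrr mulr0.
    have h : (cg p a && cg q b) || (cg p b && cg q a).
      rewrite ![cg p _]cg_sym ![cg q _]cg_sym.
      case/orP: sa => ha; case/orP: sb => hb; rewrite ?ha ?hb ?orbT //.
        by rewrite (cg_eql _ ha) cg_sym hb in ab.
      by rewrite (cg_eql _ ha) cg_sym hb in ab.
    split; apply: K_same => //.
    by rewrite ![cg a _]cg_sym ![cg b _]cg_sym [X in _ || X]andbC.
  rewrite negb_or => /andP[ap aq] /esym/negbT; rewrite negb_or => /andP[bp bq].
  by rewrite /Psi /KK K_comm // ?subrr ?mulr0 // cg_sym.
suff S0 : \sum_(q <- Z) \sum_(a <- irange 1 n) \sum_(d <- irange 1 n.-1) Psi q a (a + d) = 0.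
  apply/eqP; rewrite -subr_eq0 -[X in _ == X]S0; apply/eqP.
  have -> : chev (dunkl phi p) f = \sum_(q <- Z) \sum_(a <- irange 1 n)
      \sum_(d <- irange 1 n.-1) w a (a + d) * KK a (a + d) p q.
    rewrite exchange_big; apply: eq_bigr => a _; rewrite exchange_big.
    apply: eq_bigr => d _; rewrite -mulr_sumr; congr (_ * _).
    by rewrite [LHS]mulr_sumr; apply: eq_bigr => q _; rewrite /KK /K /edge mulrA.
  rewrite -sumrB; apply: eq_bigr => q _; rewrite /edge /chev mulr_sumr -sumrB.
  apply: eq_bigr => a _; rewrite mulr_sumr -sumrB; apply: eq_bigr => d _.
  by rewrite /Psi mulrBr /KK [K n phi f p q _ _]/K /edge /w; ring.
transitivity (\sum_(q <- Z) \sum_(z <- Z) (Psi q p z + Psi q q z)).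
  rewrite big_seq [RHS]big_seq; apply: eq_bigr => q; rewrite mem_irange => hq.
  pose s x := cg x p || cg x q.
  have [pq|pq] := boolP (cg p q).
    rewrite !big1 // => [z _|a _].
      by rewrite /Psi !(Kcg1 p q _ _ pq) !(Kcg2 _ _ p q pq) !subrr !mulr0 addr0.
    by rewrite big1 // => d _; rewrite /Psi (Kcg1 p q _ _ pq) (Kcg2 _ _ p q pq) subrr mulr0.
  transitivity (\sum_(a <- irange 1 n) \sum_(d <- irange 1 n.-1)
     (if s a != s (a + d) then Psi q a (a + d) else 0)).
    by apply: eq_bigr => a _; apply: eq_bigr => d _; case: eqP => //= /Psis.
  rewrite arc_split //; last by move=> x; rewrite /s !(cg_per _).
  pose H a := \sum_(d <- irange (1 - n%:Z) (n.-1 + n))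
    (if s (a + d) then 0 else Psi q a (a + d)).
  have pH : per H.
    move=> x; apply: eq_bigr => d _.
    have -> : x + n%:Z + d = x + d + n%:Z by ring.
    by rewrite /s !(cg_per _) Psin.
  rewrite (@sum_pair_class _ n_gt0 _ H) // big_split.
  have [near|far] := ltrP `|p - q| n%:Z; last first.
    have P0 a b : Psi q a b = 0.
      by apply/eqP; apply: contraTT far => /Psifar/andP[_ h]; rewrite -ltNge.
    by rewrite /H !big1 // => *; rewrite P0 // if_same.
  have wide a : s a -> `|p - a| < n%:Z -> H a = \sum_(z <- Z) Psi q a z.
    move=> sa ha; pose F b := Psi q a b.
    rewrite /H (eq_bigr (fun d => F (d + a))); last first.
      move=> d _; rewrite /F [d + a]addrC; case: ifP => // sd.
      by rewrite Psis // -/(s a) -/(s (a + d)) sa sd.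
    rewrite sum_irange_shift; apply: eq_big_supp; rewrite ?irange_uniq // => x /Psifar.
    by rewrite !mem_irange; lia.
  by rewrite !wide // /s ?cg_refl ?orbT ?subrr ?normr0.
pose Y q z := w q z * (KK p q q z + KK q z z p + KK z p p q).
transitivity (\sum_(q <- Z) \sum_(z <- Z) Y q z); last first.
  rewrite big1 // => q _; rewrite big1 // => z _; rewrite /Y.
  have [pq|pq] := boolP (cg p q).
    by rewrite (Kcg1 p q _ _ pq) (Kcg2 _ _ p q pq) /KK K_same ?addr0 ?mulr0 // [cg z p]cg_sym
               [cg q p]cg_sym pq cg_refl orbT.
  have [qz|qz] := boolP (cg q z).
    by rewrite (Kcg2 _ _ q z qz) (Kcg1 q z _ _ qz) /KK K_same ?addr0 ?mulr0 //
       [cg z q]cg_sym qz cg_refl orbT.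
  have [zp|zp] := boolP (cg z p).
    by rewrite (Kcg2 _ _ z p zp) (Kcg1 z p _ _ zp) /KK K_same ?addr0 ?mulr0 //
       [cg p z]cg_sym zp cg_refl orbT.
  by rewrite /KK K_cycle // mulr0.
have sw F : \sum_(q <- Z) \sum_(z <- Z) F q z = \sum_(q <- Z) \sum_(z <- Z) F z q :> R.
  by rewrite exchange_big.
have split3 F G H : \sum_(q <- Z) \sum_(z <- Z) (F q z + G q z + H q z) =
  \sum_(q <- Z) \sum_(z <- Z) F q z + \sum_(q <- Z) \sum_(z <- Z) G q z +
  \sum_(q <- Z) \sum_(z <- Z) H q z :> R.
  rewrite -!big_split; apply: eq_bigr => q _.
  by rewrite -!big_split.
have sub2 F G : \sum_(q <- Z) \sum_(z <- Z) (F q z - G q z) =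
  \sum_(q <- Z) \sum_(z <- Z) F q z - \sum_(q <- Z) \sum_(z <- Z) G q z :> R.
  by rewrite -sumrB; apply: eq_bigr => q _; rewrite -sumrB.
have -> : \sum_(q <- Z) \sum_(z <- Z) (Psi q p z + Psi q q z) =
  \sum_(q <- Z) \sum_(z <- Z) ((w p z * KK p q p z - w p z * KK p z p q) +
     w q z * KK p q q z + (- (w q z * KK q z p q))).
  by apply: eq_bigr => q _; apply: eq_bigr => z _; rewrite /Psi; ring.
(* Exchanging q and z gives the three terms a common weight, by w p z - w p q = w q z and w z q = -
   w q z. *)
rewrite split3 sub2 (sw (fun q z => w p z * KK p z p q)) -sub2.
rewrite (sw (fun q z => w p z * KK p q p z - w p q * KK p q p z)).
rewrite (sw (fun q z => - (w q z * KK q z p q))) -split3.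
apply: eq_bigr => q _; apply: eq_bigr => z _; rewrite /Y.
have E1 : KK p z p q = - KK z p p q := KCl n_gt0 phi p z p q fa.
have E2 : KK z q p z = KK q z z p.
  by rewrite /KK (KCr n_gt0 phi z q p z fa) (KCl n_gt0 phi z q z p fa) opprK.
by rewrite E1 E2 /w; ring.
Qed.

(** By antisymmetry the Dunkl element is the sum of arcs leaving p minus the sum of arcs entering p,
    the shape that summation by parts produces. *)
Lemma dunkl_split phi p f : affine_perm n f ->
  dunkl phi p f = \sum_(d <- irange 1 n.-1) (edge phi f p (p + d) - edge phi f (p - d) p).
Proof.
move=> fa; rewrite big_split /=.
transitivity (\sum_(q <- irange (p + 1) n.-1) edge phi f p q +
              \sum_(q <- irange (p + 1 - n%:Z) n.-1) edge phi f p q).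
  pose r := irange (p + 1 - n%:Z) (n.-1 + n).
  transitivity (\sum_(q <- r) edge phi f p q).
    apply: eq_big_supp; rewrite ?irange_uniq // => q.
    rewrite {1}/edge; have [->|/(sgc_near fa) h] := eqVneq (sgc f p q) 0.
      by rewrite mul0r eqxx.
    by move=> _; rewrite !mem_irange; lia.
  have -> : r = irange (p + 1 - n%:Z) (n.-1 + n.-1.+1) by congr irange; lia.
  rewrite irange_cat big_cat /= addrC irangeS big_cons.
  have -> : p + 1 - n%:Z + n.-1%:Z = p by lia.
  by rewrite {1}/edge sgc_cg ?cg_refl // mul0r add0r.
congr (_ + _).
  rewrite [RHS](eq_bigr (fun d => edge phi f p (d + p))); last by move=> d _; rewrite addrC.
  by rewrite (sum_irange_shift (edge phi f p)) [1 + p]addrC.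
rewrite [RHS](eq_bigr (fun d => edge phi f p (- d + p))); last first.
  by move=> d _; rewrite edgeC // opprK; congr edge; ring.
rewrite (sum_irange_opp (fun d => edge phi f p (d + p))) (sum_irange_shift (edge phi f p)).
by congr (\sum_(q <- irange _ _) _); lia.
Qed.

(* Only the quasi-periodic part of the weight survives, because the periodic
   part [mu] is a combination of Dunkl elements. *)
Lemma chev_collapse (mu : int -> R) phi f : affine_perm n f -> per mu ->
  (forall x, lam x = A * ((x - 1) %/ n%:Z)%Z%:~R + mu x) ->
  (forall p, dunkl phi p f = 0) ->
  chev phi f = A * \sum_(a <- irange 1 n) \sum_(d <- irange 1 n.-1)
     (if n%:Z < a + d then edge phi f a (a + d) else 0).
Proof.
move=> fa pmu lamE D0.
(* The step function changes along an arc exactly when the arc passes from n to n + 1, and then by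
   1. *)
have fl a d : 1 <= a <= n%:Z -> 1 <= d < n%:Z ->
  ((a + d - 1) %/ n%:Z)%Z = (nat_of_bool (n%:Z < a + d))%:Z /\ ((a - 1) %/ n%:Z)%Z = 0.
  move=> ha hd; split; last by apply: divz_small; lia.
  have [h|h] := ltrP n%:Z (a + d); last by apply: divz_small; lia.
  have -> : a + d - 1 = 1 * n%:Z + (a + d - 1 - n%:Z) by lia.
  by rewrite divzMDl ?divz_small //; lia.
rewrite mulr_sumr.
transitivity (\sum_(a <- irange 1 n) (A * (\sum_(d <- irange 1 n.-1)
     (if n%:Z < a + d then edge phi f a (a + d) else 0)) +
     \sum_(d <- irange 1 n.-1) (mu (a + d) - mu a) * edge phi f a (a + d))).
  rewrite /chev big_seq [RHS]big_seq; apply: eq_bigr => a; rewrite mem_irange => ha.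
  rewrite mulr_sumr -big_split big_seq [RHS]big_seq; apply: eq_bigr => d.
  rewrite mem_irange => hd; rewrite !lamE /=.
  have [-> ->] := fl a d ltac:(lia) ltac:(lia).
  by case: (_ < _) => /=; ring.
rewrite big_split /= -[RHS]addr0; congr (_ + _).
(* Summation by parts: shifting a by d in the terms with mu (a + d), which periodicity allows,
   leaves at each a the arcs entering minus the arcs leaving. *)
transitivity (\sum_(a <- irange 1 n) (- mu a) * dunkl phi a f); last first.
  by rewrite big1 // => a _; rewrite D0 mulr0.
transitivity (\sum_(a <- irange 1 n) (\sum_(d <- irange 1 n.-1) mu a * edge phi f (a - d) a) -
   \sum_(a <- irange 1 n) \sum_(d <- irange 1 n.-1) mu a * edge phi f a (a + d)); last first.
  rewrite -sumrB; apply: eq_bigr => a _; rewrite dunkl_split // mulr_sumr -sumrB.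
  by apply: eq_bigr => d _; ring.
rewrite -[in RHS]sumrB.
transitivity (\sum_(a <- irange 1 n) \sum_(d <- irange 1 n.-1) mu (a + d) * edge phi f a (a + d)
  - \sum_(a <- irange 1 n) \sum_(d <- irange 1 n.-1) mu a * edge phi f a (a + d)).
  rewrite -sumrB; apply: eq_bigr => a _; rewrite -sumrB.
  by apply: eq_bigr => d _; ring.
rewrite sumrB; congr (_ - _); rewrite exchange_big [RHS]exchange_big /=.
apply: eq_bigr => d _; pose F x := mu x * edge phi f (x - d) x.
rewrite (eq_bigr (fun a => F (a + d))); last by move=> a _; rewrite /F addrK.
rewrite sum_irange_shift; apply: sum_window => x; rewrite /F pmu.
have -> : x + n%:Z - d = x - d + n%:Z by ring.
by rewrite edge_shift1.
Qed.

End Operators.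

(** * Translations and the top element *)

Section Rank.
Variables (k n : nat).
Hypothesis n_gt0 : (0 < n)%N.

Local Notation cg := (cg n).
Local Notation tr := (tr n).
Local Notation per := (periodic n).
Local Notation core := (core k n).
Local Notation bounded := (bounded n).
Local Notation ilen := (ilen n).
Local Notation cv := (cv n).
Local Notation L := (k * (n - k))%N.

(** In [CB k n] these are the minimal elements: any other element has a lower cover, and these have
    the maximal length. *)
Definition translation (f : int -> int) := forall x, f x = x \/ f x = x + n%:Z.

Lemma translation_bounded f : translation f -> bounded f.
Proof. by move=> t x; case: (t x) => ->; lia. Qed.

Lemma ilen_le f : ilen f <= (n * n)%N%:Z.
Proof.
rewrite /ilen.
have c (F : int -> int) s M N : (forall x, F x <= M%:Z) -> \sum_(x <- irange s N) F x <= (N * M)%N%:Z.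
  move=> h; rewrite sum_irange_nat; apply: le_trans (ler_sum _ (fun i _ => h _)) _.
  by rewrite sumr_const card_ord -mulr_natr natz; lia.
apply: (c _ _ n) => a; apply: (@le_trans _ _ (n.-1 * 1)%N%:Z); last lia.
by apply: (c) => d; case: (f _ < f _).
Qed.

Lemma cv_no_between f a b c : affine_perm n f -> cv f a b -> a < b -> ~~ between f a b c.
Proof.
move=> fa v lab; have [_ lf _] := cv_bounds n_gt0 fa v lab.
case/and3P: v => /andP[ab _] /asboolP bg /eqP; rewrite (ilen_tr n_gt0 ab fa bg lab lf).
move=> e; have {}e : \sum_(x <- irange a `|b - a|) (nat_of_bool (between f a b x))%:Z == 0.
  by apply/eqP; lia.
rewrite psumr_eq0 // in e; have [hc|hc] := boolP (a < c < b); last by rewrite /between (negPf hc).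
have /allP/(_ c) := e; rewrite mem_irange => /(_ ltac:(lia)) /=.
by case: between.
Qed.

Lemma cv_of_no_between f a b : affine_perm n f -> ~~ cg a b -> bounded (f \o tr a b) ->
  a < b -> f a < f b -> (forall c, ~~ between f a b c) -> cv f a b.
Proof.
move=> fa ab bg lab lf nb; apply/and3P; split; first by rewrite /up ab lab lf.
  exact/asboolP.
rewrite (ilen_tr n_gt0 ab fa bg lab lf) big1 ?mulr0 ?addr0 // => c _.
by rewrite (negPf (nb c)).
Qed.

(** A pair with a < b <= f a < f b <= a + n gives a bounded ascent. If some c lies between, (a, c)
    is a shorter such pair, so shortening ends at a cover. *)
Lemma cover_exists f : core f -> bounded f -> ~ translation f ->
  exists a b, a < b /\ cv f a b.
Proof.
move=> [fa _] bf nt; have fI := affine_inj fa.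
pose Q (a b : int) := (a < b <= f a) && (f a < f b <= a + n%:Z).
have ncg a b : Q a b -> ~~ cg a b.
  move=> q; apply/negP => /cg_small e; move: q.
  by rewrite /Q => q; have := e ltac:(lia); lia.
have bq a b : Q a b -> bounded (f \o tr a b).
  move=> q x; have := bf x; rewrite /= /tr; case: ifP => [/cgP[y ->]|_].
    have -> : a + y * n%:Z + (b - a) = b + y * n%:Z by ring.
    by rewrite !(affine_shift _ _ fa); move: q; rewrite /Q; lia.
  case: ifP => [/cgP[y ->]|_] //.
  have -> : b + y * n%:Z + (a - b) = a + y * n%:Z by ring.
  by rewrite !(affine_shift _ _ fa); move: q; rewrite /Q; lia.
have main (m : nat) (a b : int) : (`|b - a| <= m)%N -> Q a b -> exists a b, a < b /\ cv f a b.
  elim: m a b => [|m IH] a b hm q; first by move: q; rewrite /Q; lia.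
  have [[c hc]|nb] := pselect (exists c, between f a b c).
    by apply: (IH a c); move: q hc; rewrite /Q /between; lia.
  exists a, b; have lab : a < b by move: q; rewrite /Q; lia.
  split => //; apply: cv_of_no_between => //; first exact: ncg.
  - exact: bq.
  - by move: q; rewrite /Q; lia.
  - by move=> c; apply/negP => hc; apply: nb; exists c.
(* The initial pair: with a < f a < a + n, take (a, f a) if f (f a) <= a + n, and (f a, a + n)
   otherwise. *)
have [a [na1 na2]] : exists a, f a <> a /\ f a <> a + n%:Z.
  apply: contrapT => h; apply: nt => x; apply: contrapT => h'; apply: h; exists x.
  by split => e; apply: h'; [left|right].
have := bf a => ba; set b := f a.
have nb : f b != b.
  apply/eqP => e; have : b = a by apply: fI; rewrite e.
  by rewrite /b; lia.
have := bf b => bb.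
have [h|h] := lerP (f b) (a + n%:Z).
  by apply: (main `|b - a|%N a b) => //; rewrite /Q -/b; lia.
have nbn : f b != b + n%:Z.
  apply/eqP => e; have e2 : f (a + n%:Z) = b + n%:Z by case: fa => _ ->.
  have : b = a + n%:Z by apply: fI; rewrite e2 e.
  by rewrite /b; lia.
refine (main _ b (a + n%:Z) (leqnn _) _).
by rewrite /Q; case: fa => _ ->; rewrite -/b; lia.
Qed.

Lemma cv_core f a b : core f -> cv f a b -> core (f \o tr a b).
Proof. by move=> cf /cv_ncg ab; apply: core_tr. Qed.

Lemma cv_bounded f a b : cv f a b -> bounded (f \o tr a b).
Proof. by case/and3P => _ /asboolP. Qed.

Lemma cv_len f a b : cv f a b -> ilen (f \o tr a b) = ilen f + 1.
Proof. by case/and3P => _ _ /eqP. Qed.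

Hypothesis le_kn : (k <= n)%N.

(** The window contains k moved positions, and each is inverted exactly with the n - k fixed
    positions among the n - 1 that follow it. *)
Lemma translation_len f : core f -> translation f -> ilen f = L%:Z.
Proof.
move=> [fa sf] t; pose s x := f x == x + n%:Z.
have ps : per s by move=> x; rewrite /s; case: fa => _ ->; rewrite (inj_eq (addIr _)).
have sk : \sum_(x <- irange 1 n) (nat_of_bool (s x))%:Z = k%:Z.
  have nz : n%:Z != 0 by lia.
  apply: (mulIf nz); rewrite -PoszM -sf mulr_suml; apply: eq_bigr => x _.
  by rewrite /s; case: (t x) => e; rewrite e ?eqxx; lia.
have sk' a : \sum_(x <- irange a n) (nat_of_bool (~~ s x))%:Z = (n - k)%N%:Z.
  rewrite (@sum_window n _ _ a 1); last by move=> x; rewrite ps.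
  have : \sum_(x <- irange 1 n) ((nat_of_bool (s x))%:Z + (nat_of_bool (~~ s x))%:Z) = n%:Z.
    rewrite (eq_bigr (fun=> 1%:Z)); last by move=> x _; case: (s x).
    rewrite big_const_seq count_predT size_map size_iota iter_addr addr0.
    by rewrite -[1 *+ n]/(n%:R) natz.
  by rewrite big_split /= sk => h; apply: (addrI k%:Z); rewrite h; lia.
have rw a : \sum_(d <- irange 1 n.-1) (nat_of_bool (f (a + d) < f a))%:Z =
    (nat_of_bool (s a))%:Z * (n - k)%N%:Z.
  case: (boolP (s a)) => sa; last first.
    rewrite mul0r big_seq big1 // => d; rewrite mem_irange => hd.
    by move: sa; rewrite /s; case: (t a) => ->; case: (t (a + d)) => ->; lia.
  rewrite mul1r -(sk' a) -(prednK n_gt0) irangeS big_cons sa add0r /= -[a + 1]addrC.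
  rewrite -(sum_irange_shift (fun x => (nat_of_bool (~~ s x))%:Z)).
  rewrite big_seq [RHS]big_seq; apply: eq_bigr => d; rewrite mem_irange addrC => hd.
  move: sa; rewrite /s [d + a]addrC => /eqP ->.
  by case: (t (a + d)) => ->; lia.
by rewrite /ilen (eq_bigr _ (fun a _ => rw a)) -mulr_suml sk PoszM.
Qed.

(** Lower covers raise the length and lead down to a translation; the crude bound [ilen_le] makes
    this descent terminate. *)
Lemma ilen_leL f : core f -> bounded f -> ilen f <= L%:Z.
Proof.
have [m] : exists m : nat, (n * n)%N%:Z - ilen f <= m%:Z.
  by exists `|(n * n)%N%:Z - ilen f|%N; lia.
elim: m f => [|m IH] f hm cf bf; have [t|t] := pselect (translation f);
  try by rewrite translation_len.
  have [a [b [lab v]]] := cover_exists cf bf t.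
  by have := ilen_le (f \o tr a b); rewrite (cv_len v); lia.
have [a [b [lab v]]] := cover_exists cf bf t.
have := IH (f \o tr a b); rewrite (cv_len v) => /(_ ltac:(lia) (cv_core cf v) (cv_bounded v)).
by lia.
Qed.

Lemma translationP f : core f -> bounded f -> translation f <-> ilen f = L%:Z.
Proof.
move=> cf bf; split => [|e]; first exact: translation_len.
apply: contrapT => /(cover_exists cf bf)[a [b [_ v]]].
have := ilen_leL (cv_core cf v) (cv_bounded v).
by rewrite (cv_len v); lia.
Qed.

(* The elements just above a minimal one: a translation multiplied by a
   reflection. They have exactly the two lower covers (a, b) and (b, a + n). *)
Definition near_translation f a b :=
  [/\ a < b < a + n%:Z, f a = b, f b = a + n%:Z
    & forall x, ~~ cg x a -> ~~ cg x b -> f x = x \/ f x = x + n%:Z].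

Lemma near_translation_shift f a b y : affine_perm n f -> near_translation f a b ->
  near_translation f (a + y * n%:Z) (b + y * n%:Z).
Proof.
move=> fa [h1 h2 h3 h4]; rewrite /near_translation !(affine_shift _ _ fa) h2 h3.
have e c z : cg z (c + y * n%:Z) = cg z c.
  have h : cg (c + y * n%:Z) c by apply/cgP; exists y.
  by rewrite cg_sym (cg_eql _ h) cg_sym.
split; [lia|by []|lia|].
by move=> x; rewrite !e; apply: h4.
Qed.

Lemma near_translation_rot f a b : affine_perm n f -> near_translation f a b ->
  near_translation f b (a + n%:Z).
Proof.
move=> fa [h1 h2 h3 h4]; split; [lia|by []|by case: fa => _ ->; rewrite h2|].
move=> x xb xa; apply: h4 => //.
by rewrite cg_sym -(cg_eql _ (cg_addn n a)) cg_sym.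
Qed.

Lemma near_translation_cv f a b : core f -> ilen f + 1 = L%:Z ->
  near_translation f a b -> cv f a b.
Proof.
move=> cf lf [h1 h2 h3 h4]; have fa := cf.1.
have ab : ~~ cg a b by apply/negP => /cg_small e; have := e ltac:(lia); lia.
have t : translation (f \o tr a b).
  move=> x; rewrite /= /tr; case: ifP => [/cgP[y ->]|xa].
    have -> : a + y * n%:Z + (b - a) = b + y * n%:Z by ring.
    by right; rewrite (affine_shift _ _ fa) h3; lia.
  case: ifP => [/cgP[y ->]|xb]; last by apply: h4; rewrite ?xa ?xb.
  have -> : b + y * n%:Z + (a - b) = a + y * n%:Z by ring.
  by left; rewrite (affine_shift _ _ fa) h2; lia.
apply/and3P; split; first by rewrite /up ab h2 h3; lia.
  by apply/asboolP; apply: translation_bounded.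
by rewrite (translation_len (core_tr n_gt0 ab cf) t) lf.
Qed.

(** A lower cover has maximal length, so it is a translation; b <= f a < f b <= a + n then leaves
    only f a = b and f b = a + n. *)
Lemma near_translation_ex f : core f -> bounded f -> ilen f + 1 = L%:Z ->
  exists a b, near_translation f a b.
Proof.
move=> cf bf lf; have fa := cf.1.
have [t|/(cover_exists cf bf)[a [b [lab v]]]] := pselect (translation f).
  by have := translation_len cf t; lia.
have ab := cv_ncg v; have [h1 h2 h3] := cv_bounds n_gt0 fa v lab.
have t : translation (f \o tr a b).
  by apply/translationP; rewrite ?(cv_len v) //; [apply: cv_core|apply: cv_bounded].
exists a, b; have := t a; have := t b; rewrite /= tr_l tr_r // => tb ta.
split; [lia|lia|lia|].
by move=> x xa xb; have := t x; rewrite /= tr_id.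
Qed.

(** If p is in the class of a or b, rotating the pair puts p first, and the covers (p, b) and (p, b
    - n) have opposite signs. Otherwise f p is p or p + n, and [cv_bounds] leaves no arc at p. *)
Lemma dunkl_base (R : comNzRingType) f p : core f -> bounded f -> ilen f + 1 = L%:Z ->
  dunkl n (fun=> 1 : R) p f = 0.
Proof.
move=> cf bf lf; have fa := cf.1.
have [a0 [b0 nt0]] := near_translation_ex cf bf lf.
have main b : near_translation f p b -> dunkl n (fun=> 1 : R) p f = 0.
  move=> nt; have v1 := near_translation_cv cf lf nt.
  have v2 : cv f p (b - n%:Z).
    rewrite cvC //; apply: near_translation_cv => //.
    have := near_translation_shift (-1) fa (near_translation_rot fa nt).
    by rewrite !mulN1r addrK.
  case: (nt) => h1 h2 h3 h4.
  rewrite /dunkl (@eq_big_supp _ _ _ [:: b; b - n%:Z]) ?irange_uniq //.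
  - rewrite big_cons big_seq1 /edge /sgc v1 v2 !mulr1.
    have -> : p < b by lia.
    have -> : (p < b - n%:Z) = false by lia.
    by rewrite subrr.
  - by rewrite /= inE andbT; lia.
  move=> q; rewrite /edge /sgc; case: ifP => [v _|_]; last by rewrite mul0r eqxx.
  have nq := cv_ncg v; rewrite cg_sym in nq.
  have qb : (q == b) || (q == b - n%:Z).
    have [lpq|lqp|e] := ltgtP p q; last by rewrite -e cg_refl in nq.
      have [B1 B2 B3] := cv_bounds n_gt0 fa v lpq.
      have [c|c] := boolP (cg q b).
        have -> : q = b by apply: (cg_small c); lia.
        by rewrite eqxx.
      by have := h4 q nq c; lia.
    have [B1 B2 B3] := cv_bounds n_gt0 fa (etrans (cvC n_gt0 q p fa) v) lqp.
    have [c|c] := boolP (cg q b).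
      have -> : q = b - n%:Z.
        by apply: (@cg_small n); [apply: cg_trans c _; rewrite cg_sym cg_subn|lia].
      by rewrite eqxx orbT.
    by have := h4 q nq c; lia.
  by rewrite mem_irange !inE qb; case/orP: qb => /eqP ->; lia.
have [/cgP[y e]|npa] := boolP (cg p a0).
  by apply: (main (b0 + y * n%:Z)); rewrite e; apply: near_translation_shift.
have [/cgP[y e]|npb] := boolP (cg p b0).
  apply: (main (a0 + n%:Z + y * n%:Z)); rewrite e; apply: near_translation_shift => //.
  exact: near_translation_rot.
rewrite /dunkl big1 // => q _; rewrite /edge /sgc; case: ifP; last by rewrite mul0r.
move=> v; exfalso; case: nt0 => _ _ _ /(_ p npa npb) fp.
have [lpq|lqp|e] := ltgtP p q.
- by have [] := cv_bounds n_gt0 fa v lpq; lia.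
- by have [] := cv_bounds n_gt0 fa (etrans (cvC n_gt0 q p fa) v) lqp; lia.
- by have := cv_ncg v; rewrite e cg_refl.
Qed.

Definition topf (x : int) : int := x + k%:Z.

Lemma topf_core : core topf.
Proof.
split; first split.
- by exists (fun x => x - k%:Z) => x; rewrite /topf ?addrK ?subrK.
- by move=> i; rewrite /topf; ring.
rewrite (eq_bigr (fun=> k%:Z)) => [|x _]; last by rewrite /topf; ring.
rewrite big_const_seq count_predT size_map size_iota iter_addr addr0.
by rewrite -mulr_natr natz PoszM.
Qed.

Lemma topf_bounded : bounded topf.
Proof. by move=> x; rewrite /topf; lia. Qed.

Lemma topf_len : ilen topf = 0.
Proof.
rewrite /ilen big1 // => a _; rewrite big_seq big1 // => d; rewrite mem_irange /topf.
by lia.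
Qed.

(** A descent at adjacent positions is undone by their reflection, and no position lies between
    them. Without descents [f] is a constant shift, necessarily by k. *)
Lemma upper_cover_exists f : core f -> bounded f -> f <> topf ->
  exists g a b, [/\ core g, bounded g, cv g a b, f = g \o tr a b & a < b].
Proof.
move=> cf bf nf; have fa := cf.1; have fI := affine_inj fa.
have [[a ha]|nd] := pselect (exists a, f (a + 1) < f a); last first.
  exfalso; apply: nf.
  have st a : f a + 1 <= f (a + 1).
    have : f a <> f (a + 1) by move/fI; lia.
    have : ~ (f (a + 1) < f a) by move=> h; apply: nd; exists a.
    by lia.
  have stm a (m : nat) : f a + m%:Z <= f (a + m%:Z).
    elim: m => [|m IH]; first by rewrite !addr0.
    have := st (a + m%:Z); have -> : a + m.+1%:Z = a + m%:Z + 1 by lia.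
    lia.
  (* The n increments over a period sum to n and each is at least 1, so all equal 1. *)
  have p1 : periodic 1 (fun x => f x - x).
    move=> x; change (f (x + 1) - (x + 1) = f x - x).
    have := stm (x + 1) n.-1; have -> : x + 1 + n.-1%:Z = x + n%:Z by lia.
    by case: fa => _ ->; have := st x; lia.
  have fE x : f x = x + f 0.
    have := periodicM x 0 p1; change (1%:Z) with (1 : int); rewrite /= add0r mulr1 subr0.
    by move=> <-; rewrite addrC subrK.
  apply/funext => x; rewrite fE /topf; congr (_ + _).
  case: cf => _; rewrite (eq_bigr (fun=> f 0)) => [|y _]; last by rewrite fE; ring.
  rewrite big_const_seq count_predT size_map size_iota iter_addr addr0.
  rewrite -mulr_natr natz PoszM => /mulIf -> //; lia.
have a1 : ~~ cg a (a + 1).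
  apply/negP; rewrite cg_sym => /cgP[y e]; have e1 : a + 1 = a + y * n%:Z by [].
  by move: ha; rewrite e1 (affine_shift _ _ fa); lia.
have ff : f = f \o tr a (a + 1) \o tr a (a + 1).
  by apply/funext => x /=; rewrite trK.
have ga := affine_tr a1 fa.
have g1 : (f \o tr a (a + 1)) a = f (a + 1) by rewrite /= tr_l.
have g2 : (f \o tr a (a + 1)) (a + 1) = f a by rewrite /= tr_r.
exists (f \o tr a (a + 1)), a, (a + 1).
have bg : bounded (f \o tr a (a + 1) \o tr a (a + 1)) by rewrite -ff.
split => //; [exact: core_tr| | |lia].
- by have [] := bounded_up n_gt0 a1 ga bg; rewrite ?g1 ?g2 //; lia.
apply: cv_of_no_between => //; [lia|by rewrite g1 g2|].
by move=> c; rewrite /between; lia.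
Qed.

End Rank.

(** * Weights *)

Section Weights.
Variables (k n : nat).
Hypothesis n_gt0 : (0 < n)%N.

Local Notation cg := (cg n).
Local Notation tr := (tr n).
Local Notation per := (periodic n).
Local Notation core := (core k n).
Local Notation bounded := (bounded n).
Local Notation ilen := (ilen n).
Local Notation cv := (cv n).
Local Notation L := (k * (n - k))%N.
Local Notation R := {mpoly int[n]}.

Definition alpha_sum : R := \sum_(m < n) 'X_m.

Definition mu (x : int) : R := \sum_(m < n | m%:Z < ((x - 1) %% n%:Z)%Z) 'X_m.

(** For x >= 1, the sum of the first x - 1 terms of alpha_1, alpha_2, ... with indices read modulo
    n, written as a step part plus a periodic part. *)
Definition lam (x : int) : R := alpha_sum * ((x - 1) %/ n%:Z)%Z%:~R + mu x.

Lemma mu_per : per mu.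
Proof.
move=> x; rewrite /mu; have -> : x + n%:Z - 1 = (x - 1) + n%:Z by ring.
by rewrite modzDr.
Qed.

Lemma lamn x : lam (x + n%:Z) = lam x + alpha_sum.
Proof.
rewrite /lam mu_per; have -> : x + n%:Z - 1 = 1 * n%:Z + (x - 1) by ring.
by rewrite divzMDl ?intrD /=; [ring|lia].
Qed.

(** For distinct [i] and [j] in the window, the representative of j in (i, i + n); it merges the two
    cases of t_ij and of its weight. *)
Definition arc_end (i j : nat) : int := if (i < j)%N then j%:Z else j%:Z + n%:Z.

Lemma lam_window (i : nat) : (1 <= i <= n)%N -> lam i%:Z = \sum_(m < n | (m.+1 < i)%N) 'X_m.
Proof.
move=> hi; rewrite /lam /mu divz_small ?modz_small; try lia.
by rewrite mulr0 add0r; apply: eq_bigl => m; lia.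
Qed.

Lemma t_weightE i j : (1 <= i <= n)%N -> (1 <= j <= n)%N -> i != j ->
  t_weight n i j = lam (arc_end i j) - lam i%:Z.
Proof.
move=> hi hj nij; rewrite /t_weight /arc_end; case: ltnP => lij.
  rewrite !lam_window //; apply/eqP; rewrite eq_sym subr_eq; apply/eqP.
  rewrite [LHS](bigID (fun m : 'I_n => (m.+1 < i)%N)) /= addrC.
  by congr (_ + _); apply: eq_bigl => m; lia.
rewrite lamn !lam_window // /alpha_sum [X in _ = _ + X - _](bigID (fun m : 'I_n => (m.+1 < i)%N)) /=.
rewrite [X in _ + X - _]addrC addrA addrK [RHS]addrC; congr (_ + _).
by apply: eq_bigl => m; lia.
Qed.

Lemma arc_end_ncg i j : (1 <= i <= n)%N -> (1 <= j <= n)%N -> i != j ->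
  ~~ cg i%:Z (arc_end i j).
Proof.
move=> hi hj nij; apply/negP => /cg_small e.
by have := e ltac:(rewrite /arc_end; case: ltnP; lia); rewrite /arc_end; case: ltnP; lia.
Qed.

Lemma aff_tE i j : (1 <= i <= n)%N -> (1 <= j <= n)%N -> i != j ->
  aff_t n i j = tr i%:Z (arc_end i j).
Proof.
move=> hi hj nij; apply/funext => x.
have [r hr] := window_rep n_gt0 x.
have [m hm xm] : exists2 m : nat, (1 <= m <= n)%N & x = m%:Z + r * n%:Z.
  by exists (absz (x - r * n%:Z)%R); lia.
have -> : aff_t n i j x = t_window n i j m + r * n%:Z.
  rewrite /aff_t /of_window; have -> : x - 1 = r * n%:Z + (m%:Z - 1) by rewrite xm; ring.
  rewrite modzMDl divzMDl; last lia.
  rewrite modz_small ?divz_small; try lia.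
  by rewrite addr0; congr (t_window n i j _ + _); lia.
have -> : tr i%:Z (arc_end i j) x = tr i%:Z (arc_end i j) m%:Z + r * n%:Z.
  have p : per (fun z => tr i%:Z (arc_end i j) z - z) by move=> z; rewrite tr_addn; ring.
  have := periodicM r m%:Z p; rewrite -xm /= => /(canRL (subrK _)) ->.
  by rewrite xm; ring.
congr (_ + _); rewrite /tr /t_window.
have c1 : cg m%:Z i%:Z = (m == i).
  by apply/idP/eqP => [/cg_small e|->]; rewrite ?cg_refl //; have := e ltac:(lia); lia.
have c2 : cg m%:Z (arc_end i j) = (m == j).
  have -> : cg m%:Z (arc_end i j) = cg m%:Z j%:Z.
    by rewrite /arc_end; case: ifP => // _; rewrite cg_sym (cg_eql _ (cg_addn n _)) cg_sym.
  by apply/idP/eqP => [/cg_small e|->]; rewrite ?cg_refl //; have := e ltac:(lia); lia.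
rewrite c1 c2 /arc_end; case: ltnP => lij.
  by case: eqP => [->|_]; [|case: eqP => [->|_]]; lia.
case: (eqVneq m j) => [e|nj]; first by rewrite e (_ : (j == i) = false); lia.
by case: eqP => [->|_]; lia.
Qed.

Lemma irange_iota : irange 1 n = [seq Posz i | i <- iota 1 n].
Proof.
rewrite /irange -[1%N]/(1 + 0)%N iotaDl -map_comp; apply: eq_map => x /=; lia.
Qed.

Lemma sum_arcs (V : nmodType) (G : int -> int -> V) :
  \sum_(a <- irange 1 n) \sum_(d <- irange 1 n.-1) G a (a + d) =
  \sum_(i <- iota 1 n) \sum_(j <- iota 1 n | i != j) G i%:Z (arc_end i j).
Proof.
rewrite irange_iota big_map big_seq [RHS]big_seq; apply: eq_bigr => i.
rewrite mem_iota => hi; rewrite (eq_bigr (fun d => G i%:Z (d + i%:Z))); last first.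
  by move=> d _; rewrite addrC.
rewrite (sum_irange_shift (G i%:Z)) -[RHS]big_filter -(big_map (arc_end i) predT (G i%:Z)).
apply: perm_big; apply: uniq_perm; rewrite ?irange_uniq //.
  rewrite map_inj_in_uniq ?filter_uniq ?iota_uniq // => j j'.
  rewrite !mem_filter !mem_iota /arc_end => /andP[/eqP nj hj] /andP[/eqP nj' hj'].
  by case: ltnP => h1; case: ltnP => h2 e; lia.
move=> x; rewrite mem_irange; apply/idP/mapP => [hx|[j]].
  have [h|h] := lerP x n%:Z.
    by exists (absz x); rewrite ?mem_filter ?mem_iota /arc_end; [|case: ltnP]; lia.
  by exists (absz (x - n%:Z)%R); rewrite ?mem_filter ?mem_iota /arc_end; [|case: ltnP]; lia.
by rewrite mem_filter mem_iota /arc_end => hj ->; case: ltnP; lia.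
Qed.

(** [cv] also asks for an ascent. If the pair were not an ascent of [f], it would be one of the
    product, and returning to [f] would increase the length. *)
Lemma cb_coverE f i j : core f -> bounded f ->
  (1 <= i <= n)%N -> (1 <= j <= n)%N -> i != j ->
  cb_cover k n (f \o aff_t n i j) f <-> cv f i%:Z (arc_end i j).
Proof.
move=> cf bf hi hj nij; have fa := cf.1; have ab := arc_end_ncg hi hj nij.
rewrite aff_tE //; set b := arc_end i j in ab *; set a := i%:Z in ab *.
have ga := affine_tr ab fa; split => [[]|v]; last first.
  split; try exact/CBE.
    by apply/CBE => //; split; [apply: cv_core|apply: cv_bounded].
  exists i, j; split => //; first by rewrite aff_tE.
  have : (aff_length n (f \o tr a b))%:Z = (aff_length n f).+1%:Z.
    by rewrite -addn1 PoszD !aff_lengthE // ?(cv_len v) //; apply: cv_bounded.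
  by case.
move=> /CBE-/(_ n_gt0)[cg bg] _ [_ [_ [_ _ _ _]]] => /(congr1 Posz).
rewrite -[X in _ = X]/(1 + (aff_length n f)%:Z) !aff_lengthE // => e.
apply/and3P; split; [|exact/asboolP|by rewrite e addrC].
rewrite /up ab /=; apply: contraT => nu.
have u : up n (f \o tr a b) a b.
  have nab : a != b by apply: contra ab => /eqP ->; rewrite cg_refl.
  have fab : f a != f b by apply: contra nab => /eqP/(affine_inj fa) ->.
  by rewrite /up ab /= tr_l tr_r //; lia.
have ff : f \o tr a b \o tr a b = f by apply/funext => x /=; rewrite trK.
by have := up_len n_gt0 ga u; rewrite ff => /(_ bf)[_]; lia.
Qed.

(** A power of the Chevalley operator applied to 1: the total weight of the saturated chains of m
    covers going down from [f]. *)
Fixpoint chain_sum m f : R := if m is m'.+1 then chev n lam (chain_sum m') f else 1.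

Lemma chain_sumS m f : chain_sum m.+1 f = \sum_(i <- iota 1 n) \sum_(j <- iota 1 n | i != j)
  (if cv f i%:Z (arc_end i j) then t_weight n i j * chain_sum m (f \o aff_t n i j) else 0).
Proof.
rewrite [LHS](sum_arcs (fun a b => (lam b - lam a) * edge n (chain_sum m) f a b)).
rewrite big_seq [RHS]big_seq; apply: eq_bigr => i; rewrite mem_iota => hi.
rewrite big_seq_cond [RHS]big_seq_cond; apply: eq_bigr => j.
rewrite mem_iota => /andP[hj nij].
rewrite t_weightE ?aff_tE //; try lia.
rewrite /edge /sgc; case: ifP => _; last by rewrite mul0r mulr0.
have -> : i%:Z < arc_end i j by rewrite /arc_end; case: ltnP; lia.
by rewrite mul1r.
Qed.

Hypothesis le_kn : (k <= n)%N.

Lemma dunkl_chain_sum m f p : core f -> bounded f -> ilen f + m.+1%:Z = L%:Z ->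
  dunkl n (chain_sum m) p f = 0.
Proof.
elim: m f p => [|m IH] f p cf bf lf.
  by apply: (dunkl_base n_gt0 le_kn); rewrite // -lf.
rewrite [chain_sum _]/= (_ : (fun f0 => _) = chev n lam (chain_sum m)) //.
rewrite (dunkl_chev n_gt0 lamn) ?cf.1 //; last exact: cf.1.
rewrite /chev big1 // => a _; rewrite big1 // => d _.
rewrite /edge /sgc; case: ifP => [v|_]; last by rewrite mul0r mulr0.
rewrite IH ?mulr0 //; [exact: cv_core|exact: cv_bounded|].
by rewrite (cv_len v) -lf; lia.
Qed.

(* Chains to the bottom all of whose weights involve alpha_n. *)
Fixpoint crossing_chains m (f : int -> int) : nat := if m is m'.+1 then
  (\sum_(a <- irange 1%R n) \sum_(d <- irange 1%R n.-1)
    (if (n%:Z < a + d)%R && cv f a (a + d)%R then crossing_chains m' (f \o tr a (a + d)%R) else 0))%N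
  else 1%N.

Lemma chain_sumE m f : core f -> bounded f -> ilen f + m%:Z = L%:Z ->
  chain_sum m f = (crossing_chains m f)%:R * alpha_sum ^+ m.
Proof.
elim: m f => [|m IH] f cf bf lf; first by rewrite mulr1.
rewrite [chain_sum _ _]/= (chev_collapse (A := alpha_sum) n_gt0 cf.1 mu_per) //; last first.
  by move=> p; apply: dunkl_chain_sum.
rewrite exprS mulrCA; congr (_ * _); rewrite natr_sum mulr_suml; apply: eq_bigr => a _.
rewrite natr_sum mulr_suml big_seq [RHS]big_seq; apply: eq_bigr => d.
rewrite mem_irange => hd; case: ltP => //= _; last by rewrite mul0r.
rewrite /edge /sgc; case: ifP => [v|_]; last by rewrite !mul0r.
have -> : a < a + d by lia.
rewrite mul1r IH //; [exact: cv_core|exact: cv_bounded|].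
by rewrite (cv_len v) -lf; lia.
Qed.

End Weights.

(** * Standard Young tableaux *)

Lemma card_ord_lt (m i : nat) : (i <= m)%N -> #|[set y : 'I_m | (y < i)%N]%SET| = i.
Proof.
move=> him; rewrite cardsE -sum1_card.
by rewrite -(big_ord_widen m (fun=> 1%N) him) sum1_card card_ord.
Qed.

(** A lower set of ordinals is an initial segment. This is why row or column lengths determine a
    diagram. *)
Lemma mem_lower_set (m : nat) (A : {set 'I_m}) (x : 'I_m) :
  (forall y z : 'I_m, z \in A -> (y <= z)%N -> y \in A) -> (x \in A) = (x < #|A|)%N.
Proof.
move=> low; apply/idP/idP => [xA|].
  rewrite -(@card_ord_lt m x.+1) //; apply: subset_leq_card; apply/fintype.subsetP => y.
  by rewrite inE ltnS; apply: low.
apply: contraTT => xA; rewrite -leqNgt -[X in (_ <= X)%N](card_ord_lt (ltnW (ltn_ord x))).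
apply: subset_leq_card; apply/fintype.subsetP => y yA; rewrite inE ltnNge.
by apply: contra xA; apply: low.
Qed.

Section Tableaux.
Variables (k b : nat).
Local Notation cell := ('I_k * 'I_b)%type.
Local Notation N := (k * b)%N.

Definition idealb (I : {set cell}) :=
  [forall x : cell, forall y : cell,
    [&& x \in I, (y.1 <= x.1)%N & (y.2 <= x.2)%N] ==> (y \in I)].

Lemma idealP (I : {set cell}) : reflect (forall x y : cell, x \in I ->
  (y.1 <= x.1)%N -> (y.2 <= x.2)%N -> y \in I) (idealb I).
Proof.
apply: (iffP forallP) => [h x y xI h1 h2|h x].
  by have /forallP/(_ y)/implyP := h x; apply; rewrite xI h1 h2.
by apply/forallP => y; apply/implyP => /and3P[]; apply: h.
Qed.

Definition row_len (I : {set cell}) (r : 'I_k) : nat := #|[set c | (r, c) \in I]%SET|.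
Definition col_len (I : {set cell}) (c : 'I_b) : nat := #|[set r | (r, c) \in I]%SET|.

Lemma mem_row I r c : idealb I -> ((r, c) \in I) = (c < row_len I r)%N.
Proof.
move=> /idealP h; rewrite -mem_lower_set ?inE // => y z; rewrite !inE => zI yz.
exact: h zI _ _.
Qed.

Lemma mem_col I r c : idealb I -> ((r, c) \in I) = (r < col_len I c)%N.
Proof.
move=> /idealP h; rewrite -mem_lower_set ?inE // => y z; rewrite !inE => zI yz.
exact: h zI _ _.
Qed.

Lemma row_len_anti I (r r' : 'I_k) : idealb I -> (r <= r')%N -> (row_len I r' <= row_len I r)%N.
Proof.
move=> /idealP h rr; apply: subset_leq_card; apply/fintype.subsetP => c; rewrite !inE => hc.
exact: h hc _ _.
Qed.

Lemma col_len_anti I (c c' : 'I_b) : idealb I -> (c <= c')%N -> (col_len I c' <= col_len I c)%N.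
Proof.
move=> /idealP h rr; apply: subset_leq_card; apply/fintype.subsetP => r; rewrite !inE => hc.
exact: h hc _ _.
Qed.

Definition addable (I : {set cell}) (x : cell) := (x \notin I) && idealb (x |: I)%SET.

Lemma row_len_le I r : (row_len I r <= b)%N.
Proof. by rewrite -[X in (_ <= X)%N](card_ord b) max_card. Qed.

Lemma col_len_le I c : (col_len I c <= k)%N.
Proof. by rewrite -[X in (_ <= X)%N](card_ord k) max_card. Qed.

(** A shorter row or column would leave a second missing cell below (r, c). Conversely, at such a
    corner the weakly decreasing lengths already put every smaller cell in [I]. *)
Lemma addableE I r c : idealb I -> addable I (r, c) = (row_len I r == c) && (col_len I c == r).
Proof.
move=> hI; apply/andP/andP => [[nI /idealP h]|[/eqP e1 /eqP e2]].
  have h1 : (row_len I r <= c)%N by rewrite leqNgt -mem_row.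
  have h2 : (col_len I c <= r)%N by rewrite leqNgt -mem_col.
  split; rewrite eqn_leq ?h1 ?h2 /= leqNgt; apply/negP => lt.
    have lb : (row_len I r < b)%N by apply: ltn_trans lt (ltn_ord c).
    have := h (r, c) (r, Ordinal lb); rewrite !inE eqxx /= => /(_ isT (leqnn _) (ltnW lt)).
    rewrite mem_row //= ltnn orbF => /eqP[] /(congr1 val) /= e.
    by rewrite e ltnn in lt.
  have lb : (col_len I c < k)%N by apply: ltn_trans lt (ltn_ord r).
  have := h (r, c) (Ordinal lb, c); rewrite !inE eqxx /= => /(_ isT (ltnW lt) (leqnn _)).
  rewrite mem_col //= ltnn orbF => /eqP[] /(congr1 val) /= e.
  by rewrite e ltnn in lt.
have nI : (r, c) \notin I by rewrite mem_row // e1 ltnn.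
split => //; apply/idealP => x [r' c']; rewrite !inE => /orP[/eqP -> /= h1 h2|xI h1 h2].
  have [er|nr] := eqVneq r' r; last first.
    by rewrite mem_col //; apply/orP; right; apply: leq_trans (col_len_anti hI h2);
       rewrite e2 ltn_neqAle h1 andbT; apply: contra nr => /eqP/val_inj ->.
  have [ec|nc] := eqVneq c' c; first by rewrite er ec eqxx.
  rewrite er mem_row // e1; apply/orP; right; rewrite ltn_neqAle h2 andbT.
  by apply: contra nc => /eqP/val_inj ->.
by apply/orP; right; move/idealP: hI => hI; apply: hI xI _ _.
Qed.

Lemma row_len_add (I : {set cell}) r c r' : (r, c) \notin I ->
  row_len ((r, c) |: I)%SET r' = (row_len I r' + (r' == r))%N.
Proof.
move=> nI; rewrite /row_len; have [->|nr] := eqVneq r' r.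
  have -> : [set c0 | (r, c0) \in (r, c) |: I]%SET = (c |: [set c0 | (r, c0) \in I])%SET.
    by apply/setP => y; rewrite !inE xpair_eqE eqxx.
  by rewrite cardsU1 inE nI addnC.
rewrite addn0; congr #|pred_of_set _|; apply/setP => y.
by rewrite !inE xpair_eqE (negPf nr).
Qed.

Lemma col_len_add (I : {set cell}) r c c' : (r, c) \notin I ->
  col_len ((r, c) |: I)%SET c' = (col_len I c' + (c' == c))%N.
Proof.
move=> nI; rewrite /col_len; have [->|nr] := eqVneq c' c.
  have -> : [set r0 | (r0, c) \in (r, c) |: I]%SET = (r |: [set r0 | (r0, c) \in I])%SET.
    by apply/setP => y; rewrite !inE xpair_eqE eqxx andbT.
  by rewrite cardsU1 inE nI addnC.
rewrite addn0; congr #|pred_of_set _|; apply/setP => y.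
by rewrite !inE xpair_eqE (negPf nr) andbF.
Qed.

(** Counts the ways to add m boxes in turn to a diagram, in the recursive shape of
    [crossing_chains]. *)
Fixpoint fillings m (I : {set cell}) : nat :=
  if m is m'.+1 then (\sum_(x | addable I x) fillings m' (x |: I)%SET)%N else 1%N.

Definition extends (T : {ffun cell -> 'I_N}) (s : seq cell) :=
  all (fun x => nat_of_ord (T x) == index x s) s.

Lemma extends_rcons T s x : x \notin s ->
  extends T (rcons s x) = extends T s && (nat_of_ord (T x) == size s).
Proof.
move=> xs; rewrite /extends all_rcons andbC; congr (_ && _).
  by apply: eq_in_all => y ys; rewrite -cats1 index_cat ys.
by rewrite -cats1 index_cat (negPf xs) /= eqxx addn0.
Qed.

Lemma syt_mono (T : {ffun cell -> 'I_N}) (x y : cell) : is_rect_syt T ->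
  (y.1 <= x.1)%N -> (y.2 <= x.2)%N -> (T y <= T x)%N.
Proof.
case: x y => [r c] [r' c'] /and3P[_ /forallP hr /forallP hc] /= h1 h2.
apply: (@leq_trans (T (r', c))).
  move: h2; rewrite leq_eqVlt => /orP[/eqP/val_inj -> //|lt].
  by apply: ltnW; have /forallP/(_ c')/forallP/(_ c)/implyP := hr r'; apply.
move: h1; rewrite leq_eqVlt => /orP[/eqP/val_inj -> //|lt].
by apply: ltnW; have /forallP/(_ r')/forallP/(_ r)/implyP := hc c; apply.
Qed.

Lemma syt_inj (T : {ffun cell -> 'I_N}) : is_rect_syt T -> injective T.
Proof.
case/and3P => /forallP h _ _ x y e; have /cards1P[z /setP hz] := h (T x).
have := hz x; have := hz y; rewrite !inE e eqxx => /esym/eqP -> /esym/eqP ->.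
by [].
Qed.

Lemma syt_surj (T : {ffun cell -> 'I_N}) v : is_rect_syt T -> exists x, T x = v.
Proof.
case/and3P => /forallP h _ _; have /cards1P[z /setP hz] := h v.
by exists z; have := hz z; rewrite !inE eqxx => /eqP.
Qed.

(** Prescribing the cells of the smallest entries, in the order of [s], lets the count recurse on
    the cell of the next entry. *)
Lemma syt_extends (m : nat) (s : seq cell) :
  uniq s -> (forall i, idealb [set x in take i s]%SET) -> (size s + m = N)%N ->
  (\sum_(T : {ffun cell -> 'I_N}) (is_rect_syt T && extends T s) =
   fillings m [set x in s]%SET)%N.
Proof.
elim: m s => [|m IH] s us hs sz.
  have full (x : cell) : x \in s.
    have /eqP e : [set x in s]%SET == finset.setT.
      rewrite eqEcard finset.subsetT cardsT card_prod !card_ord /=.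
      by rewrite cardsE (card_uniqP us) -sz addn0.
    by have := finset.in_setT x; rewrite -e inE.
  have lt (x : cell) : (index x s < N)%N by rewrite -sz addn0 index_mem.
  pose T0 : {ffun cell -> 'I_N} := [ffun x => Ordinal (lt x)].
  have idx (x y : cell) : (y.1 <= x.1)%N -> (y.2 <= x.2)%N -> y != x -> (index y s < index x s)%N.
    move=> h1 h2 nyx; have /idealP/(_ x y) := hs (index x s).+1.
    rewrite !inE !in_take_leq ?index_mem ?full // => /(_ (leqnn _) h1 h2).
    rewrite ltnS ltn_neqAle => ->; rewrite andbT; apply: contra nyx => /eqP e.
    by rewrite -(nth_index x (full y)) e nth_index.
  rewrite (bigD1 T0) //= big1 => [|T neT].
    have -> : is_rect_syt T0.
      apply/and3P; split.
      - apply/forallP => v; have vs : (v < size s)%N by rewrite -[size s]addn0 sz.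
        case es : s => [|x0 s']; first by rewrite es in vs.
        apply/cards1P; exists (nth x0 s v); apply/setP => x; rewrite !inE ffunE.
        apply/eqP/eqP => [[]|->].
          by move/(congr1 val) => /= <-; rewrite nth_index.
        by apply/val_inj; rewrite /= index_uniq.
      - apply/forallP => r; apply/forallP => c; apply/forallP => c'; apply/implyP => l.
        rewrite !ffunE /=; apply: idx => /=; rewrite ?(ltnW l) //.
        by rewrite xpair_eqE eqxx /=; apply: contraTneq l => ->; rewrite ltnn.
      - apply/forallP => c; apply/forallP => r; apply/forallP => r'; apply/implyP => l.
        rewrite !ffunE /=; apply: idx => /=; rewrite ?(ltnW l) //.
        by rewrite xpair_eqE eqxx andbT; apply: contraTneq l => ->; rewrite ltnn.
    have -> // : extends T0 s by apply/allP => x _; rewrite ffunE.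
  apply/eqP; rewrite eqb0; apply: contra neT => /andP[_ /allP e].
  by apply/eqP/ffunP => x; apply/val_inj; rewrite ffunE /=; apply/eqP; apply: e.
have idI : idealb [set x in s]%SET by have := hs (size s); rewrite take_size.
transitivity (\sum_(T : {ffun cell -> 'I_N}) \sum_(x | addable [set x in s]%SET x)
   (is_rect_syt T && extends T (rcons s x)))%N; last first.
  rewrite exchange_big /=; apply: eq_bigr => x /andP[nx ix].
  rewrite inE in nx.
  have e : (x |: [set x0 in s])%SET = [set x0 in rcons s x]%SET.
    by apply/setP => y; rewrite !inE mem_rcons inE.
  rewrite e; apply: IH; rewrite ?rcons_uniq ?nx ?size_rcons ?addSnnS // => i.
  have [hi|hi] := leqP i (size s); first by rewrite -cats1 takel_cat // hs.
  by rewrite take_oversize ?size_rcons // -e.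
apply: eq_bigr => T _; have [hT|] := boolP (is_rect_syt T); last first.
  by rewrite big1.
have lsN : (size s < N)%N by rewrite -sz addnS ltnS leq_addr.
have [hext|next] := boolP (extends T s); last first.
  rewrite big1 // => x /andP[nx _]; rewrite inE in nx.
  by rewrite extends_rcons // (negPf next).
(* [T] selects one extension of [s]: the cell of entry [size s], which is addable because the
   smaller entries fill exactly [s]. *)
have [x0 ex0] := syt_surj (Ordinal lsN) hT.
have small (y : cell) : (T y < size s)%N = (y \in s).
  apply/idP/idP => [lt|ys].
    case es : s => [|z s']; first by rewrite es in lt.
    have ln : (nth z s (T y)) \in s by apply: mem_nth.
    have /allP/(_ _ ln) := hext; rewrite index_uniq // => /eqP/val_inj/(syt_inj hT) e.
    by rewrite -es -e.
  by have /allP/(_ _ ys)/eqP -> := hext; rewrite index_mem.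
have nx0 : x0 \notin s by rewrite -small ex0 ltnn.
rewrite (bigD1 x0) /=; last first.
  rewrite /addable inE nx0; apply/idealP => x y; rewrite !inE -!small.
  move=> hx h1 h2; have := syt_mono hT h1 h2.
  have {hx} hx : (T x <= size s)%N by case/orP: hx => [/eqP ->|/ltnW //]; rewrite ex0.
  move=> le; have := leq_trans le hx; rewrite leq_eqVlt => /orP[/eqP e|->]; rewrite ?orbT //.
  have : T y = T x0 by apply/val_inj; rewrite ex0.
  by move/(syt_inj hT) ->; rewrite eqxx.
rewrite extends_rcons // hext ex0 eqxx /= big1 ?addn0 // => x /andP[/andP[nx _] nxx].
rewrite inE in nx; rewrite extends_rcons // hext /=; case: eqP => // e.
case/eqP: nxx; apply: (syt_inj hT); apply/val_inj.
by rewrite ex0.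
Qed.

Lemma num_rect_sytE : num_rect_syt k b = fillings N finset.set0.
Proof.
have e0 : [set x in [::]]%SET = finset.set0 :> {set cell} by apply/setP => x; rewrite !inE.
have h0 i : idealb [set x in take i ([::] : seq cell)]%SET.
  by apply/idealP => x y; rewrite !inE.
have := @syt_extends N [::] isT h0 (add0n _); rewrite e0 => <-.
rewrite /num_rect_syt -sum1_card big_mkcond; apply: eq_bigr => T _.
by rewrite inE /extends andbT; case: (is_rect_syt T).
Qed.

End Tableaux.

(** * Grassmannian elements *)

Section Grassmannian.
Variables (k n : nat).
Hypothesis n_gt0 : (0 < n)%N.
Hypothesis le_kn : (k <= n)%N.

Local Notation cg := (cg n).
Local Notation tr := (tr n).
Local Notation core := (core k n).
Local Notation bounded := (bounded n).
Local Notation cv := (cv n).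
Local Notation b := (n - k)%N.
Local Notation cell := ('I_k * 'I_b)%type.

(* The window positions attached to the rows and columns of the k x (n - k)
   rectangle. *)
Definition rpos (r : 'I_k) : int := n%:Z - r%:Z.
Definition cpos (c : 'I_b) : int := c%:Z + 1.

(* [I] is the Young diagram of the k-subset of [1, n] obtained by subtracting
   [n] from the window values that exceed [n]. *)
Definition grass (f : int -> int) (I : {set cell}) :=
  [/\ core f, bounded f, idealb I,
      forall c : 'I_b, f (cpos c) = cpos c + k%:Z - (col_len I c)%:Z
    & forall r : 'I_k, f (rpos r) = rpos r + k%:Z + (row_len I r)%:Z].

Lemma pos_cases x : 1 <= x <= n%:Z -> (exists c, x = cpos c) \/ (exists r, x = rpos r).
Proof.
move=> hx; have [h|h] := lerP x b%:Z; [left|right].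
  have lt : (absz (x - 1)%R < b)%N by lia.
  by exists (Ordinal lt); rewrite /cpos /=; lia.
have lt : (absz (n%:Z - x)%R < k)%N by lia.
by exists (Ordinal lt); rewrite /rpos /=; lia.
Qed.

Lemma shift_eq0 (u v y : int) : u + y * n%:Z = v -> `|v - u| < n%:Z -> y = 0.
Proof.
move=> e h; have c : cg v u by apply/cgP; exists y; rewrite e.
have := cg_small c h; rewrite -e => /(canRL (addKr _)); rewrite addNr => /eqP.
by rewrite mulf_eq0 => /orP[/eqP //|]; lia.
Qed.

Lemma grass_ncg (r : 'I_k) (c : 'I_b) : ~~ cg (rpos r) (cpos c + n%:Z).
Proof.
have := ltn_ord r; have := ltn_ord c => hc hr.
apply/negP => /cg_small e; have := e ltac:(rewrite /rpos /cpos; lia).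
by rewrite /rpos /cpos; lia.
Qed.

(** Column positions have values at most n and row positions values above n, so B <= f a and f B <=
    a + n force [a] to be a row position and B - n a column position. *)
Lemma grass_cvP f I (a B : int) : grass f I -> 1 <= a <= n%:Z -> n%:Z < B < a + n%:Z ->
  cv f a B -> exists r c, [/\ a = rpos r, B = cpos c + n%:Z & addable I (r, c)].
Proof.
move=> [cf bf idI fc fr] ha hB v; have fa := cf.1.
have laB : a < B by lia.
have [B1 B2 B3] := cv_bounds n_gt0 fa v laB.
have [r ar] : exists r, a = rpos r.
  case: (pos_cases ha) => // -[c ac]; exfalso.
  have := ltn_ord c; move: B1; rewrite ac fc /cpos; lia.
have BE : B = (B - n%:Z) + n%:Z by rewrite subrK.
have fB : f B = f (B - n%:Z) + n%:Z by rewrite {1}BE; case: fa => _ ->.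
have [c Bc] : exists c, B - n%:Z = cpos c.
  case: (@pos_cases (B - n%:Z)) => //; first lia.
  move=> [r' er]; exfalso; have := ltn_ord r'.
  by move: B3; rewrite fB er fr /rpos; lia.
exists r, c; split => //; first by rewrite -Bc subrK.
(* Otherwise the position of the value f a + 1 would lie strictly between a and B, since values
   increase along rows and along columns of the window. *)
have step : f (cpos c) + n%:Z = f a + 1.
  apply: contrapT => ne.
  have lt : f a + 1 < f (cpos c) + n%:Z by rewrite -Bc -fB; rewrite -Bc -fB in ne; lia.
  have [x fx] : exists x, f x = f a + 1.
    by case: fa => -[g _ gK] _; exists (g (f a + 1)).
  have := cv_no_between n_gt0 x fa v laB; apply/negP/negPn.
  rewrite /between fx fB Bc; apply/andP; split; last lia.
  have [y hy] := window_rep n_gt0 x; set x0 := x - y * n%:Z in hy.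
  have xE : x = x0 + y * n%:Z by rewrite /x0 subrK.
  have fx0 : f x0 + y * n%:Z = f a + 1 by rewrite -(affine_shift _ _ fa) -xE.
  have ra := ltn_ord r; have ca := ltn_ord c.
  have fcc := fc c; have frr := fr r; rewrite -ar in frr.
  have rl := row_len_le I r; have cl := col_len_le I c.
  case: (pos_cases hy) => [[c' ex]|[r' ex]].
    have := fc c'; have := col_len_le I c'; have := ltn_ord c'; rewrite -ex => h1 h2 h3.
    have y1 : y = 1.
      have u1 : f x0 <= n%:Z by rewrite h3 ex /cpos; lia.
      have u2 : 1 <= f x0 by have := bf x0; lia.
      apply/eqP; rewrite -subr_eq0; apply/eqP.
      apply: (@shift_eq0 (f x0 + n%:Z) (f a + 1)); first by rewrite -fx0; ring.
      by move: frr fcc lt; rewrite ar /rpos /cpos; lia.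
    have : f (cpos c') < f (cpos c) by rewrite -ex; lia.
    rewrite !fc => lf; have {}lf : (c' < c)%N.
      rewrite ltnNge; apply/negP => le; have := col_len_anti idI le; move: lf.
      by rewrite /cpos; lia.
    by rewrite xE y1 ex BE Bc ar /rpos /cpos; lia.
  have := fr r'; have := row_len_le I r'; have := ltn_ord r'; rewrite -ex => h1 h2 h3.
  have y0 : y = 0.
    have u1 : n%:Z < f x0 by rewrite h3 ex /rpos; lia.
    have u2 : f x0 <= 2 * n%:Z by rewrite h3 ex /rpos; lia.
    apply: (shift_eq0 fx0).
    by move: frr fcc lt; rewrite ar /rpos /cpos; lia.
  have : f (rpos r) < f (rpos r') by rewrite -ex -ar; lia.
  rewrite !fr => lf; have {}lf : (r' < r)%N.
    rewrite ltnNge; apply/negP => le; have := row_len_anti idI le; move: lf.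
    by rewrite /rpos; lia.
  by rewrite xE y0 ex BE Bc ar /rpos /cpos; lia.
(* Now [step] says that the lengths of row r and column c sum to r + c. In [I] they would sum to at
   least r + c + 2; outside, they are at most c and r, hence equal to them. *)
rewrite addableE //; move: step; rewrite ar fr fc /rpos /cpos => step.
have [rc|rc] := boolP ((r, c) \in I).
  by have := rc; rewrite mem_row // => h1; have := rc; rewrite mem_col // => h2; lia.
by have := rc; rewrite mem_row // => h1; have := rc; rewrite mem_col // => h2; lia.
Qed.

(** At a corner the two exchanged values are consecutive integers, so no value lies between them. *)
Lemma grass_add f I r c : grass f I -> addable I (r, c) ->
  cv f (rpos r) (cpos c + n%:Z) /\
  grass (f \o tr (rpos r) (cpos c + n%:Z)) ((r, c) |: I)%SET.
Proof.
move=> [cf bf idI fc fr] ad; have fa := cf.1; have ncg := grass_ncg r c.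
have [nI idI'] := andP ad.
move: ad; rewrite addableE // => /andP[/eqP er /eqP ec].
have ra := ltn_ord r; have ca := ltn_ord c.
set a := rpos r in ncg *; set B := cpos c + n%:Z in ncg *.
have fA : f a = a + k%:Z + c%:Z by rewrite /a fr er.
have fB : f B = f a + 1 by rewrite fA /B; case: fa => _ ->; rewrite fc ec /a /rpos /cpos; lia.
set g := f \o tr a B.
have ga : affine_perm n g by apply: affine_tr.
have gA : g a = f a + 1 by rewrite /g /= tr_l.
have gB : g B = f a by rewrite /g /= tr_r.
have bg : bounded g.
  move=> x; have [/cgP[y ->]|xa] := boolP (cg x a).
    by rewrite (affine_shift _ _ ga) gA fA /a /rpos; lia.
  have [/cgP[y ->]|xb] := boolP (cg x B).
    by rewrite (affine_shift _ _ ga) gB fA /B /a /rpos /cpos; lia.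
  by rewrite /g /= tr_id.
split.
  apply: cv_of_no_between => //; first by rewrite /a /B /rpos /cpos; lia.
    by rewrite fB; lia.
  by move=> x; rewrite /between fB; lia.
split => //; first exact: core_tr.
- move=> c'; rewrite col_len_add //; have [->|nc] := eqVneq c' c.
    have -> : cpos c = B + (-1) * n%:Z by rewrite /B; ring.
    by rewrite (affine_shift _ _ ga) gB fA /B /a ec /rpos /cpos; lia.
  have lc := ltn_ord c'.
  have nc' : (c' : nat) <> c by move/val_inj => e; rewrite e eqxx in nc.
  rewrite addn0 /g /= tr_id ?fc //; apply/negP.
    move=> /cg_small e; have := e ltac:(rewrite /a /rpos /cpos; lia).
    by rewrite /a /rpos /cpos; lia.
  rewrite cg_sym (cg_eql _ (cg_addn n _)) => /cg_small e.
  by have := e ltac:(rewrite /cpos; lia); rewrite /cpos; lia.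
- move=> r'; rewrite row_len_add //; have [->|nr] := eqVneq r' r.
    by rewrite -/a gA fA er; lia.
  have lr := ltn_ord r'.
  have nr' : (r' : nat) <> r by move/val_inj => e; rewrite e eqxx in nr.
  rewrite addn0 /g /= tr_id ?fr //; apply/negP.
    by move=> /cg_small e; have := e ltac:(rewrite /a /rpos; lia); rewrite /a /rpos; lia.
  rewrite cg_sym (cg_eql _ (cg_addn n _)) => /cg_small e.
  by have := e ltac:(rewrite /rpos /cpos; lia); rewrite /rpos /cpos; lia.
Qed.

Lemma crossing_chains_fillings m f I : grass f I -> crossing_chains n m f = fillings m I.
Proof.
elim: m f I => [//|m IH] f I hf /=.
pose F (p : int * int) : nat := if (n%:Z < p.1 + p.2) && cv f p.1 (p.1 + p.2)
  then crossing_chains n m (f \o tr p.1 (p.1 + p.2)) else 0%N.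
transitivity (\sum_(p <- [seq (a, d) | a <- irange 1 n, d <- irange 1 n.-1]) F p).
  by rewrite big_allpairs.
(* The second entry is the length of the arc from [rpos r] to [cpos c] + n. *)
pose h (x : cell) : int * int := (rpos x.1, x.2%:Z + 1 + x.1%:Z).
have hE x : (h x).1 + (h x).2 = cpos x.2 + n%:Z by rewrite /h /rpos /cpos /=; ring.
transitivity (\sum_(x <- enum {: cell}) F (h x)); last first.
  rewrite big_enum /= [RHS]big_mkcond; apply: eq_bigr => -[r c] _.
  rewrite /F hE /=; case: (boolP (addable I (r, c))) => [ad|nad].
    have [v hg] := grass_add hf ad.
    rewrite v (_ : n%:Z < _ = true); last by rewrite /cpos; lia.
    exact: IH.
  case: ifP => // /andP[lt v]; exfalso.
  have ra := ltn_ord r; have ca := ltn_ord c.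
  have [||r' [c' [er ec]]] := grass_cvP hf _ _ v; try by rewrite /rpos /cpos; lia.
  have -> : r' = r by apply/val_inj; move: er; rewrite /rpos /=; lia.
  have -> : c' = c by apply/val_inj; move: ec; rewrite /cpos /=; lia.
  by rewrite (negPf nad).
symmetry; apply: sum_reindex.
- move=> [r c] [r' c'] [] /= e1 e2; congr (_, _); apply/val_inj; move: e1 e2; rewrite /rpos /=; lia.
- exact: enum_uniq.
- by apply: allpairs_uniq; rewrite ?irange_uniq // => -[? ?] [].
move=> [a d] hF; apply/mapP/allpairsP => [[[r c] _ [-> ->]]|[[a' d'] /= [h1 h2 [ea ed]]]].
  have ra := ltn_ord r; have ca := ltn_ord c.
  exists (rpos r, c%:Z + 1 + r%:Z); rewrite !mem_irange /rpos /=; split; [lia|lia|by []].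
move: h1 h2; rewrite !mem_irange -ea -ed => h1 h2.
move: hF; rewrite /F /=; case: ifP => [/andP[lt v] _|_]; last by rewrite eqxx.
have [||r [c [er ec _]]] := grass_cvP hf _ _ v; [lia|lia|].
exists (r, c); rewrite ?mem_enum // /h /=; congr (_, _) => //.
by move: ec; rewrite er /rpos /cpos; lia.
Qed.

Lemma grass_top : grass (topf k) finset.set0.
Proof.
split.
- exact: topf_core.
- exact: topf_bounded.
- by apply/idealP => x y; rewrite inE.
- move=> c; rewrite /col_len (_ : [set r | _]%SET = finset.set0) ?cards0 ?subr0 //.
  by apply/setP => r; rewrite !inE.
- move=> r; rewrite /row_len (_ : [set c | _]%SET = finset.set0) ?cards0 ?addr0 //.
  by apply/setP => c; rewrite !inE.
Qed.

Lemma crossing_chains_top : crossing_chains n (k * b) (topf k) = num_rect_syt k b.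
Proof. by rewrite (crossing_chains_fillings _ grass_top) num_rect_sytE. Qed.

End Grassmannian.

(** * Maximal chains *)

Section Chains.
Variables (k n : nat).
Hypothesis n_gt0 : (0 < n)%N.
Hypothesis le_kn : (k <= n)%N.

Local Notation tr := (tr n).
Local Notation core := (core k n).
Local Notation bounded := (bounded n).
Local Notation cv := (cv n).
Local Notation L := (k * (n - k))%N.
Local Notation R := {mpoly int[n]}.
Local Notation aperm := (int -> int).
Local Notation len := (aff_length n).
Local Notation cover := (cb_cover k n).
Local Notation le := (cb_le k n).

Lemma cover_len g f : cover g f -> len g = (len f).+1.
Proof. by case=> _ _ [i [j []]]. Qed.

Lemma le_len g f : le g f -> g = f \/ (len f < len g)%N.
Proof.
elim=> [x y /cover_len -> |x|x y z _ IH1 _ IH2]; [by right|by left|].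
case: IH1 => [->//|h1]; case: IH2 => [<-|h2]; first by right.
by right; apply: ltn_trans h1.
Qed.

Lemma le_cover x y : le x y -> x = y \/ exists2 g, cover g y & le x g.
Proof.
elim=> [u v h|u|u v w h1 IH1 h2 IH2]; [|by left|].
  by right; exists u => //; apply: rt_refl.
case: IH2 => [<-//|[g hg vg]]; right; exists g => //.
exact: rt_trans h1 vg.
Qed.

Lemma cv_cover f a b : core f -> bounded f -> cv f a b -> cover (f \o tr a b) f.
Proof.
move=> cf bf; have fa := cf.1.
have main c d : c < d -> cv f c d -> cover (f \o tr c d) f.
  move=> lcd v; have [B1 B2 B3] := cv_bounds n_gt0 fa v lcd.
  have [y hy] := window_rep n_gt0 c.
  (* The arc is translated to start at i in [1, n]; its end D lies in (i, i + n) and is j or j +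
     n. *)
  pose i := absz (c - y * n%:Z)%R; pose D := d - y * n%:Z.
  have iE : i%:Z = c - y * n%:Z by rewrite /i; lia.
  pose j := absz (if (D <= n%:Z)%R then D else D - n%:Z)%R.
  have hD : i%:Z < D < i%:Z + n%:Z by rewrite /D iE; lia.
  have hi : (1 <= i <= n)%N by lia.
  have hj : (1 <= j <= n)%N by rewrite /j; case: ifP; lia.
  have nij : i != j by rewrite /j; case: ifP; lia.
  have De : arc_end n i j = D by rewrite /arc_end /j; case: ltnP; case: ifP; lia.
  have e : tr c d = tr i%:Z D.
    by rewrite -[RHS](tr_shift n _ _ y); congr tr; rewrite ?iE ?/D; ring.
  rewrite e -De -aff_tE //; apply/(cb_coverE n_gt0 cf bf hi hj nij).
  rewrite De -(cv_shift _ _ y fa).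
  by have <- : c = i%:Z + y * n%:Z; [rewrite iE subrK|rewrite /D subrK].
have [lab|lba|->] := ltgtP a b; first exact: main.
  move=> v; have ab := cv_ncg v; rewrite tr_C //; apply: main => //.
  by rewrite cvC.
by move=> /cv_ncg; rewrite cg_refl.
Qed.

Lemma lenE f : CB k n f -> (len f)%:Z = ilen n f.
Proof. by move=> /(CBE k n_gt0)[[fa _] bf]; apply: aff_lengthE. Qed.

Lemma len_leL f : CB k n f -> (len f <= L)%N.
Proof.
move=> hf; rewrite -lez_nat lenE //; have [cf bf] := (CBE k n_gt0 f).1 hf.
exact: ilen_leL.
Qed.

Lemma CB_top : CB k n (topf k).
Proof. by apply/CBE => //; split; [apply: topf_core|apply: topf_bounded]. Qed.

Lemma len_top : len (topf k) = 0%N.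
Proof. by have := lenE CB_top; rewrite topf_len // => -[]. Qed.

Lemma le_top f : CB k n f -> le f (topf k).
Proof.
have [m] := ubnP (len f); elim: m f => // m IH f lf hf.
have [->|nf] := pselect (f = topf k); first exact: rt_refl.
have [cf bf] := (CBE k n_gt0 f).1 hf.
have [g [a [b [cg bg v e lab]]]] := upper_cover_exists n_gt0 le_kn cf bf nf.
have cv' := cv_cover cg bg v; rewrite -e in cv'.
apply: (rt_trans _ _ _ g); first exact: rt_step.
apply: IH; last by case: cv'.
by have := cover_len cv'; lia.
Qed.

Lemma cover_below f : CB k n f -> (len f < L)%N -> exists g, cover g f.
Proof.
move=> hf lf; have [cf bf] := (CBE k n_gt0 f).1 hf.
have nt : ~ translation n f.
  by move/(translation_len n_gt0 le_kn cf); rewrite -lenE // => -[]; lia.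
have [a [b [lab v]]] := cover_exists n_gt0 cf bf nt.
by exists (f \o tr a b); apply: cv_cover.
Qed.

(** Arguments are reversed so that a [path] descends. *)
Definition cvr (f g : aperm) : bool := `[< cover g f >].

Lemma path_CB f q x : CB k n f -> path cvr f q -> x \in f :: q -> CB k n x.
Proof.
elim: q f => [|g q IH] f hf /=; first by rewrite inE => _ /eqP ->.
case/andP => /asboolP c pq; rewrite inE => /orP[/eqP -> //|].
by apply: IH => //; case: c.
Qed.

Lemma path_le f q x : path cvr f q -> x \in f :: q -> le x f.
Proof.
elim: q f => [|g q IH] f /=; first by rewrite inE => _ /eqP ->; apply: rt_refl.
case/andP => /asboolP c pq; rewrite inE => /orP[/eqP ->|h]; first exact: rt_refl.
by apply: rt_trans (IH _ pq h) _; apply: rt_step.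
Qed.

Lemma path_total f q x y : path cvr f q -> x \in f :: q -> y \in f :: q ->
  le x y \/ le y x.
Proof.
elim: q f => [|g q IH] f pq hx hy.
  by move: hx hy; rewrite !mem_seq1 => /eqP -> /eqP ->; left; apply: rt_refl.
move: (hx); rewrite in_cons => /orP[/eqP ->|hx']; first by right; apply: path_le hy.
move: (hy); rewrite in_cons => /orP[/eqP ->|hy']; first by left; apply: path_le hx.
by case/andP: pq => _ pq; apply: IH pq hx' hy'.
Qed.

Lemma path_len f q r : path cvr f q -> (len f <= r <= len f + size q)%N ->
  exists2 x, x \in f :: q & len x = r.
Proof.
elim: q f => [|g q IH] f /=.
  by move=> _ h; exists f; rewrite ?inE ?eqxx //; lia.
case/andP => /asboolP c pq h; have lg := cover_len c.
have [e|ne] := eqVneq r (len f); first by exists f; rewrite ?inE ?eqxx.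
have [|x hx lx] := IH g pq; first by rewrite lg; lia.
by exists x; rewrite // inE hx orbT.
Qed.

Lemma path_len_inj f q x y : path cvr f q -> x \in f :: q -> y \in f :: q ->
  len x = len y -> x = y.
Proof.
move=> pq hx hy e; case: (path_total pq hx hy) => /le_len [] //; rewrite e ltnn //.
Qed.

Lemma path_uniq f q : path cvr f q -> uniq (f :: q).
Proof.
elim: q f => // g q IH f /andP[/asboolP c pq].
rewrite cons_uniq IH // andbT; apply/negP => hf; have := path_le pq hf; have := cover_len c.
by move=> lg /le_len []; [move=> e; move: lg; rewrite e|]; lia.
Qed.

(** Such a path has an element of every possible length, and comparable elements of equal length
    coincide. *)
Lemma path_maximal q : path cvr (topf k) q -> size q = L ->
  maximal_chains k n [set` topf k :: q].
Proof.
move=> pq sq; split.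
  split => [x hx|x y hx hy]; first exact: path_CB CB_top pq hx.
  exact: path_total pq hx hy.
move=> D [DCB Dtot] sub; apply/seteqP; split => // d Dd.
have hd := DCB _ Dd.
have [|x hx lx] := @path_len _ _ (len d) pq; first by rewrite len_top sq len_leL.
have := Dtot _ _ Dd (sub _ hx).
by case=> /le_len [e|]; rewrite ?lx ?ltnn // /= -?e //; rewrite e.
Qed.

Lemma chain_extend (C : set aperm) m f : cb_chain k n C -> CB k n f -> (len f + m = L)%N ->
  exists q, [/\ path cvr f q, size q = m & forall x, C x -> le x f -> x \in f :: q].
Proof.
move=> [CCB Ctot]; elim: m f => [|m IH] f hf lf.
  exists [::]; split => // x Cx /le_len []; first by move=> ->; rewrite inE.
  by have := len_leL (CCB _ Cx); lia.
suff [g c hg] : exists2 g, cover g f & forall x, C x -> le x f -> x <> f -> le x g.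
  have [||q [pq sq hq]] := IH g; [by case: c|by rewrite (cover_len c); lia|].
  exists (g :: q); split => /=; first by rewrite pq andbT; apply/asboolP.
    by rewrite sq.
  move=> x Cx xf; rewrite inE; case: eqP => //= ne.
  by apply: hq => //; apply: hg.
pose C' x := [/\ C x, le x f & x <> f].
have [[x0 hx0]|emp] := pselect (exists x, C' x); last first.
  have [g c] := cover_below hf ltac:(lia).
  by exists g => // x Cx xf ne; exfalso; apply: emp; exists x.
(* The element of [C] strictly below [f] with least length is the highest one; the path steps to an
   element covered by [f] and above it. *)
pose Q r := `[< exists2 x, C' x & len x = r >].
have exQ : exists r, Q r by exists (len x0); apply/asboolP; exists x0.
have [r /asboolP[y [Cy yf ny] ly] rmin] := ex_minnP exQ.
have [e|[g c yg]] := le_cover yf; first by case: ny.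
exists g => // x Cx xf ne.
have lyx : (len y <= len x)%N by rewrite ly; apply: rmin; apply/asboolP; exists x.
suff xy : le x y by apply: rt_trans xy yg.
case: (Ctot _ _ Cx Cy) => // /le_len [->|]; first exact: rt_refl.
by lia.
Qed.

(** * Enumeration and weights of descending paths *)

Definition below (f : aperm) : seq aperm :=
  [seq f \o aff_t n ij.1 ij.2 | ij <- [seq (i, j) | i <- iota 1 n, j <- iota 1 n]
     & (ij.1 != ij.2) && `[< cover (f \o aff_t n ij.1 ij.2) f >]].

Lemma mem_below f g : (g \in below f) = cvr f g.
Proof.
apply/mapP/asboolP => [[[i j]]|hg].
  by rewrite mem_filter /= => /andP[/andP[_ /asboolP h] _] ->.
have [_ _ [i [j [hi hj nij e _]]]] := hg.
exists (i, j) => //; rewrite mem_filter /= nij /= -e; apply/andP; split; first exact/asboolP.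
by apply/allpairsP; exists (i, j); rewrite !mem_iota /=; split => //; lia.
Qed.

Lemma below_uniq f : CB k n f -> uniq (below f).
Proof.
move=> /(CBE k n_gt0)[[fa _] _]; have fI := affine_inj fa.
rewrite map_inj_in_uniq; last first.
  move=> [i j] [i' j']; rewrite !mem_filter /=.
  move=> /andP[/andP[nij _] /allpairsP[[x y] /= [hx hy [ei ej]]]].
  move=> /andP[/andP[nij' _] /allpairsP[[x' y'] /= [hx' hy' [ei' ej']]]] e.
  move: hx hy hx' hy'; rewrite !mem_iota -ei -ej -ei' -ej' => hi hj hi' hj'.
  have et : aff_t n i j = aff_t n i' j'.
    by apply/funext => z; apply: fI; have := congr1 (fun h => h z) e.
  by have [||||-> ->] := aff_t_inj _ _ nij _ _ nij' et; first [lia|done].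
apply: filter_uniq; apply: allpairs_uniq; rewrite ?iota_uniq // => -[? ?] [? ?] //.
Qed.

Lemma cover_weightE f i j : CB k n f -> (1 <= i <= n)%N -> (1 <= j <= n)%N -> i != j ->
  cover_weight n (f \o aff_t n i j) f = t_weight n i j.
Proof.
move=> /(CBE k n_gt0)[[fa _] _] hi hj nij; have fI := affine_inj fa.
have uq i' j' : (1 <= i' <= n)%N -> (1 <= j' <= n)%N ->
  ((i' != j') && `[< f \o aff_t n i j = f \o aff_t n i' j' >]) = (i' == i) && (j' == j).
  move=> hi' hj'; apply/andP/andP => [[nij' /asboolP e]|[/eqP -> /eqP ->]]; last first.
    by split => //; apply/asboolP.
  have et : aff_t n i j = aff_t n i' j'.
    by apply/funext => z; apply: fI; have := congr1 (fun h => h z) e.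
  by have [-> ->] := aff_t_inj hi hj nij hi' hj' nij' et.
have mi x : (x \in iota 1 n) = (1 <= x <= n)%N by rewrite mem_iota; lia.
rewrite /cover_weight /index_iota subn1 [n.+1.-1]/=.
rewrite (bigD1_seq i) ?iota_uniq ?mi //= [X in _ + X]big_seq_cond [X in _ + X]big1.
  rewrite addr0 big_mkcond (bigD1_seq j) ?iota_uniq ?mi //= uq ?eqxx //=.
  rewrite [X in _ + X]big_seq_cond big1 ?addr0 // => j' /andP[+ nj]; rewrite mi => hj'.
  by rewrite uq // (negPf nj) andbF.
move=> i' /andP[+ ni]; rewrite mi => hi'; rewrite big_seq_cond big1 // => j' /andP[].
by rewrite mi => hj'; rewrite uq // (negPf ni).
Qed.

Lemma chain_sum_below m f : CB k n f ->
  chain_sum n m.+1 f = \sum_(g <- below f) cover_weight n g f * chain_sum n m g.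
Proof.
move=> hf; have [cf bf] := (CBE k n_gt0 f).1 hf.
rewrite chain_sumS // big_map big_filter [RHS]big_mkcond [RHS]big_allpairs /=.
rewrite big_seq [RHS]big_seq; apply: eq_bigr => i; rewrite mem_iota => hi.
rewrite big_mkcond big_seq [RHS]big_seq; apply: eq_bigr => j; rewrite mem_iota => hj.
case: (boolP (i != j)) => //= nij; rewrite cover_weightE //; try lia.
have hi' : (1 <= i <= n)%N by lia.
have hj' : (1 <= j <= n)%N by lia.
have e : `[< cover (f \o aff_t n i j) f >] = cv f i%:Z (arc_end n i j).
  by apply/asboolP/idP => h; apply/(cb_coverE n_gt0 cf bf hi' hj' nij).
by rewrite e.
Qed.

Fixpoint paths m (f : aperm) : seq (seq aperm) :=
  if m is m'.+1 then [seq g :: q | g <- below f, q <- paths m' g] else [:: [::]].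

Lemma mem_paths m f q : (q \in paths m f) = path cvr f q && (size q == m).
Proof.
elim: m f q => [|m IH] f q /=.
  by rewrite inE; case: q => [|g q] //=; rewrite andbF.
apply/allpairsPdep/andP => [[g [p [hg hp ->]]]|[]].
  by move: hg hp; rewrite mem_below IH => /= -> /andP[-> /eqP ->].
case: q => [|g q] //= /andP[c pq] /eqP[sq]; exists g, q; rewrite mem_below IH pq sq eqxx.
by split.
Qed.

Lemma paths_uniq m f : CB k n f -> uniq (paths m f).
Proof.
elim: m f => [|m IH] f hf //=; apply: allpairs_uniq_dep; first exact: below_uniq.
  by move=> g; rewrite mem_below => /asboolP[hg _ _]; apply: IH.
by move=> [g q] [g' q'] _ _ /= [-> ->].
Qed.

Fixpoint path_weight (f : aperm) (q : seq aperm) : R :=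
  if q is g :: q' then cover_weight n g f * path_weight g q' else 1.

Lemma sum_paths m f : CB k n f -> \sum_(q <- paths m f) path_weight f q = chain_sum n m f.
Proof.
elim: m f => [|m IH] f hf; first by rewrite big_seq1.
rewrite chain_sum_below // [paths _ _]/= big_allpairs_dep big_seq [RHS]big_seq.
apply: eq_bigr => g; rewrite mem_below => /asboolP[hg _ _].
by rewrite -IH // mulr_sumr.
Qed.

(** [zip] stops at the shorter list, so [zip q (f :: q)] lists the consecutive pairs, lower element
    first. *)
Lemma path_weightE f q :
  path_weight f q = \prod_(p <- zip q (f :: q)) cover_weight n p.1 p.2.
Proof. by elim: q f => [|g q IH] f; rewrite /= ?big_nil // big_cons IH. Qed.

(** Each step adds 1 to the length, so elements of a path in a cover relation are consecutive;
    [chain_weight] thus sees exactly the steps. *)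
Lemma zip_covers f q x y : path cvr f q -> x \in f :: q -> y \in f :: q ->
  cover x y -> (x, y) \in zip q (f :: q).
Proof.
elim: q f => [|g q IH] f pq hx hy c.
  move: hx hy; rewrite !mem_seq1 => /eqP ex /eqP ey.
  by have := cover_len c; rewrite ex ey; lia.
move: (pq) => /= /andP[/asboolP cg pq']; rewrite inE.
have lc := cover_len c; have lcg := cover_len cg.
have lf z : z \in g :: q -> (len f < len z)%N.
  by move=> hz; have [->|] := le_len (path_le pq' hz); rewrite lcg; lia.
move: (hx); rewrite inE => /orP[/eqP ex|hx'].
  have [e|] := le_len (path_le pq hy); move: lc; rewrite ?e ex; lia.
move: (hy); rewrite inE => /orP[/eqP ey|hy']; last by rewrite IH ?orbT.
have -> : x = g.
  by apply: (path_len_inj pq') => //; rewrite ?inE ?eqxx // lc ey lcg.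
by rewrite ey eqxx.
Qed.

Lemma covers_zip f q p : path cvr f q -> p \in zip q (f :: q) ->
  [/\ p.1 \in f :: q, p.2 \in f :: q & cover p.1 p.2].
Proof.
elim: q f => [//|g q IH] f /= /andP[/asboolP c pq]; rewrite inE => /orP[/eqP -> /=|hp].
  by rewrite !in_cons !eqxx orbT.
by have [h1 h2 h3] := IH _ pq hp; rewrite !(in_cons f) h1 h2 !orbT.
Qed.

Lemma chain_weightE f q : path cvr f q ->
  chain_weight k n [set` f :: q] = path_weight f q.
Proof.
move=> pq; rewrite path_weightE /chain_weight.
have -> : [set p | [/\ [set` f :: q] p.1, [set` f :: q] p.2 & cover p.1 p.2]] =
    [set` zip q (f :: q)].
  apply/seteqP; split => [[x y] /= [hx hy c]|p hp] /=; first exact: zip_covers.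
  exact: covers_zip.
have uz : uniq (unzip1 (zip q (f :: q))).
  by rewrite unzip1_zip /= ?leqnSn //; have := path_uniq pq => /= /andP[].
by rewrite -fsbig_seq // (map_uniq uz).
Qed.

(** A maximal chain lies below the top, so [chain_extend] places it inside a full path, which it
    equals by maximality. *)
Lemma maximal_chainsE :
  maximal_chains k n = [set` [seq [set` topf k :: q] | q <- paths L (topf k)]].
Proof.
apply/seteqP; split => [C [hC maxC]|C /mapP[q + ->]] /=; last first.
  by rewrite mem_paths => /andP[pq /eqP sq]; apply: path_maximal.
have [|q [pq sq hq]] := @chain_extend C L (topf k) hC CB_top; first by rewrite len_top.
apply/mapP; exists q; first by rewrite mem_paths pq sq eqxx.
symmetry; apply: maxC; first by case: (path_maximal pq sq).
move=> x Cx; apply: hq => //; apply: le_top.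
by case: hC => CCB _; apply: CCB.
Qed.

(** The elements of a path have distinct lengths, so their set determines their order. *)
Lemma path_set_inj f q q' : path cvr f q -> path cvr f q' ->
  [set` f :: q] = [set` f :: q'] -> q = q'.
Proof.
elim: q f q' => [|g q IH] f [|g' q'] //.
- move=> _ pq' /seteqP[_ /(_ g')] ; rewrite /= mem_seq1 in_cons mem_head orbT => /(_ isT)/eqP e.
  by have := path_uniq pq'; rewrite cons_uniq e mem_head.
- move=> pq _ /seteqP[/(_ g) + _] ; rewrite /= mem_seq1 in_cons mem_head orbT => /(_ isT)/eqP e.
  by have := path_uniq pq; rewrite cons_uniq e mem_head.
move=> pq pq' e.
have eg : g = g'.
  have : g \in f :: g' :: q'.
    by have /seteqP[/(_ g) + _] := e; rewrite /= in_cons mem_head orbT; apply.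
  move=> hg; apply: (path_len_inj pq') => //; first by rewrite in_cons mem_head orbT.
  move: pq pq' => /= /andP[/asboolP c _] /andP[/asboolP c' _].
  by rewrite (cover_len c) (cover_len c').
subst g'; congr (_ :: _).
have tail s : path cvr f (g :: s) -> [set` g :: s] = [set` f :: g :: s] `\` [set f].
  move=> /path_uniq/= /andP[nf _]; apply/seteqP; split => x /=.
    by move=> hx; split; [rewrite inE hx orbT|move=> ex; rewrite -ex hx in nf].
  by move=> [+ ne]; rewrite inE => /orP[/eqP //|].
move: (pq) (pq') => /= /andP[_ pq1] /andP[_ pq1']; apply: (IH g) => //.
by rewrite (tail _ pq) (tail _ pq') e.
Qed.

Lemma sum_maximal_chains :
  \sum_(C \in maximal_chains k n) chain_weight k n C =
  (num_rect_syt k (n - k))%:R * (\sum_(m < n) 'X_m) ^+ L :> R.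
Proof.
rewrite maximal_chainsE -fsbig_seq; last first.
  rewrite map_inj_in_uniq; first exact: paths_uniq CB_top.
  move=> q q'; rewrite !mem_paths => /andP[pq _] /andP[pq' _].
  exact: path_set_inj.
rewrite big_map big_seq (eq_bigr (path_weight (topf k))); last first.
  by move=> q; rewrite mem_paths => /andP[pq _]; apply: chain_weightE.
rewrite -big_seq sum_paths; last exact: CB_top.
rewrite (chain_sumE n_gt0 le_kn (topf_core k n)) ?crossing_chains_top //; first exact: topf_bounded.
by rewrite topf_len // add0r.
Qed.

End Chains.

Theorem theorem3p2 (k n : nat) (hkn : (k <= n)%N) (hn : (1 <= n)%N) :
  \sum_(C \in maximal_chains k n) chain_weight k n C
    = (num_rect_syt k (n - k))%:R * (\sum_(m < n) 'X_m) ^+ (k * (n - k))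
    :> {mpoly int[n]}.
Proof. exact: sum_maximal_chains. Qed.
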